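(* Let $\Omega \subset \mathbb{C}^n$ be a domain satisfying Condition $D$. 1. If $\{z^{\alpha}\}_{\alpha \in \mathbb{N}^n}$ is an orthogonal subset of $A^2(\Omega)$ (i.e. $\langle z^\alpha, z^\beta\rangle = 0$ whenever $\alpha \neq \beta$), then $\operatorname{int}(\overline{\Omega})$, the interior of the closure of $\Omega$, is Reinhardt. 2. If any two monomials $z^{\alpha}$ and $z^{\beta}$ ($\alpha,\beta\in\mathbb{N}^n$) with $|\alpha| \neq |\beta|$ are orthogonal in $A^2(\Omega)$, then $\operatorname{int}(\overline{\Omega})$ is circular. 3. If for some $j \in \{1,\ldots,n\}$, the monomials $z^{\alpha}$ and $z^{\beta}$ ($\alpha,\beta\in\mathbb{N}^n$) are orthogonal in $A^2(\Omega)$ whenever $\alpha_j \neq \beta_j$, then $\operatorname{int}(\overline{\Omega})$ is Hartogs in the $j^{th}$ coordinate. In particular, in cases 1, 2, 3, if $\Omega = \operatorname{int}(\overline{\Omega})$, then $\Omega$ is Reinhardt, circular, or Hartogs in the $j^{th}$ coordinate, respectively.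
   Context: $\mathbb{N}$ denotes the natural numbers including $0$. For $\alpha=(\alpha_1,\ldots,\alpha_n)\in\mathbb{N}^n$, $z^{\alpha}=z_1^{\alpha_1}\cdots z_n^{\alpha_n}$ and $|\alpha|=\alpha_1+\cdots+\alpha_n$. A domain is a nonempty connected open set. $dv$ is Lebesgue volume measure on $\mathbb{C}^n=\mathbb{R}^{2n}$. $A^2(\Omega)$ is the Bergman space of holomorphic functions on $\Omega$ that are square-integrable with respect to $dv$, with inner product $\langle f,g\rangle=\int_\Omega f\bar g\,dv$. Orthogonality is with respect to this inner product. $\|\cdot\|_{L^2(\Omega)}$ is the $L^2$-norm on $\Omega$ with respect to $dv$. Condition $D$: let $\Omega\subset\mathbb{C}^n$ be a domain such that $z^\alpha\in A^2(\Omega)$ for all $\alpha\in\mathbb{N}^n$. For $j\in\{1,\ldots,n\}$, $\Omega$ satisfies Condition $D_j$ if $\sum_{k=1}^\infty \|z_j^k\|_{L^2(\Omega)}^{-1/k}=\infty$. $\Omega$ satisfies Condition $D$ if it satisfies Condition $D_j$ for all $j=1,\ldots,n$. (So a domain satisfying Condition $D$ in particular has all monomials $z^\alpha$, $\alpha \in \mathbb{N}^n$, in its Bergman space.) Let $S=\{\zeta\in\mathbb{C}:|\zeta|=1\}$. A domain $U\subset\mathbb{C}^n$ is: - Reinhardt if $U$ is invariant under $(z_1,\ldots,z_n)\mapsto(\lambda_1z_1,\ldots,\lambda_nz_n)$ for every $(\lambda_1,\ldots,\lambda_n)\in S^n$; - circular if $U$ is invariant under $z\mapsto(\lambda z_1,\ldots,\lambda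 z_n)$ for every $\lambda\in S$; - Hartogs in the $j^{th}$ coordinate if $U$ is invariant under $z\mapsto(z_1,\ldots,z_{j-1},\lambda z_j,z_{j+1},\ldots,z_n)$ for every $\lambda\in S$. Here invariant under a map means that the image of $U$ under the map equals $U$. *)

(* Defs.v *)
From HB Require Import structures.
From mathcomp Require Import all_boot all_order all_algebra complex.
From mathcomp Require Import all_classical all_reals all_analysis.

Set Implicit Arguments.
Unset Strict Implicit.
Unset Printing Implicit Defensive.

Import Order.TTheory GRing.Theory Num.Theory.
Import numFieldNormedType.Exports.

Local Open Scope classical_set_scope.
Local Open Scope ring_scope.
Local Open Scope complex_scope.

(* MathComp-Analysis puts the metric topology on abstract numClosedFieldTypes;
   these instances make it available on the concrete field R[i]. *)
Set Warnings "-redundant-canonical-projection".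
HB.instance Definition _ (R : rcfType) :=
  PseudoPointedMetric.copy R[i] (R[i] : numClosedFieldType)^o.
HB.instance Definition _ (R : rcfType) :=
  NormedModule.copy R[i] (R[i] : numClosedFieldType)^o.

(* A named copy of m1 \x m2: on the bare product, canonical inference of the
   sigma-finite structure only succeeds for subprobabilities. *)
Definition prod_measure d1 d2 (T1 : measurableType d1) (T2 : measurableType d2)
    (R : realType) (m1 : {sigma_finite_measure set T1 -> \bar R})
    (m2 : {sigma_finite_measure set T2 -> \bar R}) :
    set (T1 * T2)%type -> \bar R :=
  (m1 \x m2)%E.

HB.instance Definition _ d1 d2 (T1 : measurableType d1)
    (T2 : measurableType d2) (R : realType)
    (m1 : {sigma_finite_measure set T1 -> \bar R})
    (m2 : {sigma_finite_measure set T2 -> \bar R}) :=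
  Measure.copy (prod_measure m1 m2) (m1 \x m2)%E.

Lemma prod_measure_sigma_finite d1 d2 (T1 : measurableType d1)
    (T2 : measurableType d2) (R : realType)
    (m1 : {sigma_finite_measure set T1 -> \bar R})
    (m2 : {sigma_finite_measure set T2 -> \bar R}) :
  sigma_finite setT (prod_measure m1 m2).
Proof.
have /sigma_finiteP[F [TF ndF Foo]] := sigma_finiteT m1.
have /sigma_finiteP[G [TG ndG Goo]] := sigma_finiteT m2.
exists (fun n => F n `*` G n).
  rewrite -setXTT TF TG predeqE => -[x y]; split.
    move=> [/= [n _ Fnx] [k _ Gky]]; exists (maxn n k) => //; split.
    - by move: x Fnx; exact/subsetPset/ndF/leq_maxl.
    - by move: y Gky; exact/subsetPset/ndG/leq_maxr.
  by move=> [n _ []/= ? ?]; split; exists n.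
move=> k; have [mF ltF] := Foo k; have [mG ltG] := Goo k.
split; first exact: measurableX.
by rewrite /prod_measure product_measure1E// lte_mul_pinfty// ge0_fin_numE.
Qed.

HB.instance Definition _ d1 d2 (T1 : measurableType d1)
    (T2 : measurableType d2) (R : realType)
    (m1 : {sigma_finite_measure set T1 -> \bar R})
    (m2 : {sigma_finite_measure set T2 -> \bar R}) :=
  Measure_isSigmaFinite.Build _ _ _ (prod_measure m1 m2)
    (prod_measure_sigma_finite m1 m2).

Definition cons_pair (T : Type) (n : nat) (p : T * n.-tuple T) : n.+1.-tuple T :=
  [tuple of p.1 :: p.2].

Lemma measurable_cons_pair d (T : measurableType d) n :
  measurable_fun [set: T * n.-tuple T] (@cons_pair T n).
Proof. exact: measurable_cons. Qed.

Definition cons_measure d (T : measurableType d) (R : realType) (n : nat)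
    (m : {sigma_finite_measure set T -> \bar R})
    (mn : {sigma_finite_measure set (n.-tuple T) -> \bar R}) :
    set (n.+1.-tuple T) -> \bar R :=
  pushforward (prod_measure m mn) (@cons_pair T n).

HB.instance Definition _ d (T : measurableType d) (R : realType) (n : nat)
    (m : {sigma_finite_measure set T -> \bar R})
    (mn : {sigma_finite_measure set (n.-tuple T) -> \bar R}) :=
  Measure.copy (cons_measure m mn)
    (measure_function_pushforward__canonical__measure_function_Measure
       (prod_measure m mn) (@measurable_cons_pair d T n)).

Lemma cons_measure_sigma_finite d (T : measurableType d) (R : realType) n
    (m : {sigma_finite_measure set T -> \bar R})
    (mn : {sigma_finite_measure set (n.-tuple T) -> \bar R}) :
  sigma_finite setT (cons_measure m mn).
Proof.
have [F FT Foo] := sigma_finiteT (prod_measure m mn).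
pose g (x : n.+1.-tuple T) : T * n.-tuple T := (thead x, [tuple of behead x]).
have mg : measurable_fun [set: n.+1.-tuple T] g.
  apply/measurable_fun_pairP; split; first exact: (@measurable_tnth _ T).
  exact: measurable_behead.
have gK p : g (cons_pair p) = p.
  by case: p => a t; congr (_, _); apply/val_inj.
exists (fun i => g @^-1` F i).
  by rewrite -preimage_bigcup -FT preimage_setT.
move=> i; have [mF lF] := Foo i; split.
  by rewrite -[X in measurable X]setTI; exact: mg.
rewrite /cons_measure /pushforward.
suff -> : @cons_pair T n @^-1` (g @^-1` F i) = F i by [].
by apply/seteqP; split => p /=; rewrite gK.
Qed.

HB.instance Definition _ d (T : measurableType d) (R : realType) (n : nat)
    (m : {sigma_finite_measure set T -> \bar R})
    (mn : {sigma_finite_measure set (n.-tuple T) -> \bar R}) :=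
  Measure_isSigmaFinite.Build _ _ _ (cons_measure m mn)
    (cons_measure_sigma_finite m mn).

(* n-fold product m \x ... \x m on n.-tuple T; the empty product is the unit
   mass on the one-point space 0.-tuple T. *)
Fixpoint power_measure d (T : measurableType d) (R : realType)
    (m : {sigma_finite_measure set T -> \bar R}) (n : nat) :
    {sigma_finite_measure set (n.-tuple T) -> \bar R} :=
  match n with
  | 0 => \d_([tuple] : 0.-tuple T)
  | n'.+1 => cons_measure m (power_measure m n')
  end.

Notation plane R := (measurableTypeR R * measurableTypeR R)%type.

(* Lebesgue measure on R^2n = (R^2)^n, points being listed as
   ((x_1, y_1), ..., (x_n, y_n)). *)
Definition volume (R : realType) (n : nat) :
    {sigma_finite_measure set (n.-tuple (plane R)) -> \bar R} :=
  power_measure (prod_measure (@lebesgue_measure R) (@lebesgue_measure R)) n.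

Section several_complex_variables.
Context {R : realType} {n : nat}.
Implicit Types (Omega U : set 'rV[R[i]]_n) (f g : 'rV[R[i]]_n -> R[i]).

Definition of_real_coords (x : n.-tuple (plane R)) : 'rV[R[i]]_n :=
  \row_j ((tnth x j).1 +i* (tnth x j).2).

(* dv lives on R^2n, so a domain of integration in C^n is pulled back along the
   identification R^2n = C^n. *)
Definition real_integral Omega (h : 'rV[R[i]]_n -> R) : R :=
  Rintegral (volume R n) (of_real_coords @^-1` Omega) (h \o of_real_coords).

Definition complex_integral Omega f : R[i] :=
  real_integral Omega (fun z => complex.Re (f z)) +i*
  real_integral Omega (fun z => complex.Im (f z)).

Definition abs_sq f (z : 'rV[R[i]]_n) : R := Normc.normc (f z) ^+ 2.

Definition square_integrable Omega f : Prop :=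
  (volume R n).-integrable (of_real_coords @^-1` Omega)
    (fun x => (abs_sq f (of_real_coords x))%:E).

Definition L2norm Omega f : R := Num.sqrt (real_integral Omega (abs_sq f)).

Definition domain Omega : Prop :=
  [/\ Omega !=set0, open Omega & connected Omega].

Definition holomorphic Omega f : Prop :=
  forall z, Omega z -> differentiable f z.

(* Elements of A^2(Omega) are represented by functions on all of C^n, of which
   only the values on Omega matter. *)
Definition bergman_space Omega : set ('rV[R[i]]_n -> R[i]) :=
  [set f | holomorphic Omega f /\ square_integrable Omega f].

Definition inner Omega f g : R[i] :=
  complex_integral Omega (fun z => f z * (g z)^*).

Definition monomial (alpha : {ffun 'I_n -> nat}) (z : 'rV[R[i]]_n) : R[i] :=
  \prod_(k < n) z 0 k ^+ alpha k.

Definition degree (alpha : {ffun 'I_n -> nat}) : nat := \sum_(k < n) alpha k.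

Definition conditionDj Omega (j : 'I_n) : Prop :=
  (\sum_(1 <= k <oo)
     (L2norm Omega (fun z => z 0 j ^+ k) `^ (- k%:R^-1))%:E = +oo)%E.

Definition conditionD Omega : Prop :=
  [/\ domain Omega, forall alpha, bergman_space Omega (monomial alpha)
    & forall j, conditionDj Omega j].

Definition reinhardt U : Prop :=
  domain U /\
  forall lambda : 'I_n -> R[i], (forall k, `|lambda k| = 1) ->
    (fun z : 'rV[R[i]]_n => \row_k (lambda k * z 0 k)) @` U = U.

Definition circular U : Prop :=
  domain U /\
  forall lambda : R[i], `|lambda| = 1 ->
    (fun z : 'rV[R[i]]_n => lambda *: z) @` U = U.

Definition hartogs (j : 'I_n) U : Prop :=
  domain U /\
  forall lambda : R[i], `|lambda| = 1 ->
    (fun z : 'rV[R[i]]_n =>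
       \row_k (if k == j then lambda * z 0 k else z 0 k)) @` U = U.

End several_complex_variables.

(* Main.v *)
Require Import Defs.
From HB Require Import structures.
From mathcomp Require Import all_boot all_order all_algebra complex.
From mathcomp Require Import all_classical all_reals all_analysis.
From mathcomp Require Import measurable_realfun ring lra zify.

Set Implicit Arguments.
Unset Strict Implicit.
Unset Printing Implicit Defensive.

Import Order.TTheory GRing.Theory Num.Theory.
Import numFieldNormedType.Exports.

Local Open Scope classical_set_scope.
Local Open Scope ring_scope.
Local Open Scope complex_scope.

(** Let T be a rotation z_k |-> lambda_k z_k for which the orthogonality relations
    make the moments int_Omega z^alpha conj(z)^beta dv invariant under composition
    with T.  If F_k is the k-th derivative of t |-> int cos(t u + c) G - int cos(t u' + c) G',
    where u and u' are one real coordinate before and after T and G, G' are products of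
    functions of the other coordinates, then |F_k| <= C ||z_j^k||_{L^2}, and equality of
    the moments says that all F_k vanish at 0.  Condition D_j and Carleman's inequality
    put F_0 in a quasianalytic class, so F_0 = 0 by Bang's argument; as Gaussians are limits
    of powers of cosines, monomials in that coordinate may be replaced by Gaussians.
    Doing so one coordinate at a time shows that every isotropic Gaussian has the same
    integral over Omega before and after composition with T.  If T p were at positive
    distance from Omega for some p in Omega, concentrating the Gaussian at T p would
    contradict this.  Hence T maps Omega into its closure. *)

Local Notation normc := Normc.normc.
Local Notation Re := complex.Re.
Local Notation Im := complex.Im.

(** * Carleman's inequality and quasianalyticity *)

(** Carleman's inequality stated without roots: [b k] is any lower bound for the geometric mean of
    [a 0], ..., [a k]. *)
Lemma carleman_inequality (R : realType) (a b : nat -> R) (n : nat) :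
  (forall k, 0 <= a k) -> (forall k, 0 <= b k) ->
  (forall k, b k ^+ k.+1 <= \prod_(j < k.+1) a j) ->
  \sum_(k < n) b k <= expR 1 * \sum_(j < n) a j.
Proof.
move=> a0 b0 ab.
(* Weights with c_0 ... c_k = (k + 2)^(k + 1), so that AM-GM applied to the c_j a_j
   produces the telescoping factor 1 / ((k + 1)(k + 2)). *)
pose c j : R := j.+2%:R ^+ j.+1 / j.+1%:R ^+ j.
have c0 j : 0 <= c j by rewrite divr_ge0 // exprn_ge0.
have prodc k : \prod_(j < k.+1) c j = k.+2%:R ^+ k.+1.
  elim: k => [|k IH]; first by rewrite big_ord1 /c expr0 divr1.
  by rewrite big_ord_recr /= IH /c mulrC divfK.
pose T k := \sum_(j < k) c j * a j.
(* Summation by parts with 1/((k+1)(k+2)) = 1/(k+1) - 1/(k+2). *)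
have telescope m : \sum_(k < m) T k.+1 / (k.+1%:R * k.+2%:R) =
    \sum_(j < m) c j * a j / j.+1%:R - T m / m.+1%:R.
  elim: m => [|m IH]; first by rewrite !big_ord0 /T big_ord0 mul0r subr0.
  rewrite !big_ord_recr /= IH /T big_ord_recr /=.
  have h1 : m.+1%:R != 0 :> R by rewrite pnatr_eq0.
  have h2 : m.+2%:R != 0 :> R by rewrite pnatr_eq0.
  have -> : m.+2%:R = m.+1%:R + 1 :> R by rewrite -natr1.
  rewrite -[m.+2%:R]natr1 in h2.
  move: h1 h2 (T m) (c m * a m) => + + x y; move: m.+1%:R => z z0 z1.
  by field; rewrite z0 z1.
have T0 k : 0 <= T k by apply: sumr_ge0 => j _; rewrite mulr_ge0.
have bT k : b k <= T k.+1 / (k.+1%:R * k.+2%:R).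
  rewrite invfM mulrA ler_pdivlMr ?ltr0n //.
  rewrite -(@ler_pXn2r _ k.+1) ?nnegrE ?mulr_ge0 ?divr_ge0 //.
  rewrite exprMn -prodc.
  apply: (@le_trans _ _ (\prod_(j < k.+1) (c j * a j))).
    have -> : \prod_(j < k.+1) (c j * a j) = \prod_(j < k.+1) c j * \prod_(j < k.+1) a j.
      by rewrite big_split.
    rewrite [leLHS]mulrC; apply: ler_wpM2l => //.
    by apply: prodr_ge0.
  have := @leif_AGM R 'I_k.+1 predT (fun j => c j * a j).
  rewrite cardT size_enum_ord => H.
  by rewrite /T; apply: H => i _; rewrite mulr_ge0.
apply: le_trans (ler_sum _ (fun (k : 'I_n) _ => bT k)) _.
rewrite telescope mulr_sumr lerBlDr.
apply: le_trans (_ : _ <= \sum_(i < n) expR 1 * a i) _; last first.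
  by rewrite lerDl divr_ge0.
apply: ler_sum => j _; rewrite mulrAC ler_wpM2r //.
have -> : c j / j.+1%:R = (1 + j.+1%:R^-1) ^+ j.+1.
  rewrite /c -mulrA -invfM -exprSr -expr_div_n; congr (_ ^+ _).
  by rewrite -natr1 mulrDl divff ?pnatr_eq0 // mul1r.
apply: le_trans (_ : _ <= expR (j.+1%:R^-1) ^+ j.+1) _.
  by rewrite ler_pXn2r ?nnegrE ?expR_ge0 ?addr_ge0 ?invr_ge0 // expR_ge1Dx.
by rewrite -expRM_natl divff // pnatr_eq0.
Qed.

(** Log-convexity carries a zero of [M] upwards from any index, and downwards as far as index 1. One
    zero would therefore annihilate every [M k] with k >= 1. *)
Lemma logconvex_gt0 (R : realType) (M : nat -> R) :
  (forall k, 0 <= M k) -> (forall k, M k.+1 ^+ 2 <= M k * M k.+2) ->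
  (\sum_(1 <= k <oo) (M k `^ (- k%:R^-1))%:E = +oo)%E ->
  forall k, 0 < M k.
Proof.
move=> M0 Mc Moo.
have down k : M k.+1 = 0 -> M 1%N = 0.
  elim: k => [//|k IH] M2; apply: IH.
  by apply/eqP; rewrite -sqrf_eq0 eq_le sqr_ge0 -[X in _ <= X](mulr0 (M k)) -M2 Mc.
have up k : M k = 0 -> M k.+1 = 0.
  move=> Mk; apply/eqP; rewrite -sqrf_eq0 eq_le sqr_ge0.
  by rewrite -[X in _ <= X](mul0r (M k.+2)) -Mk Mc.
have M1 : M 1%N != 0.
  apply/eqP => M1; suff : (\sum_(1 <= k <oo) (M k `^ (- k%:R^-1))%:E = 0)%E.
    by rewrite Moo.
  apply: eseries0 => k k1 _.
  have -> : M k = 0 by case: k k1 => // k _; elim: k => [//|k IH]; exact: up.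
  (* By convention 0 to a nonzero power is 0, even for a negative exponent, so the terms vanish
     instead of being infinite. *)
  by rewrite powR0 // oppr_eq0 invr_eq0 pnatr_eq0 -lt0n.
move=> k; rewrite lt_def M0 andbT; apply: contra_neq M1.
by case: k => [|k]; [exact: up|exact: down].
Qed.

(** The product of the ratios up to index [k] telescopes to M_0 / M_(k+1), so Carleman's inequality
    bounds the series of M_k^(-1/k) by a multiple of the sum of the ratios. This turns Condition D_j
    into the divergence used in Bang's argument. *)
Lemma logconvex_ratio_divergence (R : realType) (M : nat -> R) :
  (forall k, 0 <= M k) -> (forall k, M k.+1 ^+ 2 <= M k * M k.+2) ->
  (\sum_(1 <= k <oo) (M k `^ (- k%:R^-1))%:E = +oo)%E ->
  forall A : R, exists n, A <= \sum_(j < n) M j / M j.+1.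
Proof.
move=> M0 Mc Moo A; have Mpos := logconvex_gt0 M0 Mc Moo.
apply: contrapT => /forallNP bounded.
(* Since m <= 1, m^(k+1) <= m <= M_0: scaling by [m] absorbs the numerator M_0 for all [k] at
   once. *)
pose m := Num.min 1 (M 0%N).
have m0 : 0 < m by rewrite lt_min ltr01 Mpos.
pose b k := m * M k.+1 `^ (- k.+1%:R^-1).
have b0 k : 0 <= b k by rewrite mulr_ge0 ?powR_ge0 // ltW.
have ba k : b k ^+ k.+1 <= \prod_(j < k.+1) (M j / M j.+1).
  have -> : \prod_(j < k.+1) (M j / M j.+1) = M 0%N / M k.+1.
    elim: k => [|k IH]; first by rewrite big_ord1.
    rewrite big_ord_recr /= IH mulrA divfK //.
    by rewrite gt_eqF.
  rewrite exprMn -[(_ `^ _) ^+ _]powR_mulrn ?powR_ge0 // -powRrM mulNr mulVf ?pnatr_eq0 //.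
  rewrite powRN powRr1 // ler_wpM2r ?invr_ge0 //.
  apply: (@le_trans _ _ m); last by rewrite ge_min lexx orbT.
  by rewrite exprS ler_piMr ?(ltW m0) // exprn_ile1 // ?(ltW m0) // ge_min lexx.
have bsum n : \sum_(k < n) b k <= expR 1 * A.
  apply: le_trans (carleman_inequality (a := fun j => M j / M j.+1) n _ b0 ba) _.
    by move=> k; apply: divr_ge0.
  rewrite ler_wpM2l ?expR_ge0 // leNgt; apply/negP => lt.
  by apply: (bounded n); exact: ltW.
suff : (\sum_(1 <= k <oo) (M k `^ (- k%:R^-1))%:E <= (m^-1 * (expR 1 * A))%:E)%E.
  by rewrite Moo leye_eq.
apply: lime_le; first by apply: is_cvg_nneseries => k _ _; rewrite lee_fin powR_ge0.
apply: nearW => n; rewrite sumEFin lee_fin -ler_pdivrMl ?invr_gt0 // invrK.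
rewrite big_add1 big_mkord mulr_sumr; exact: bsum.
Qed.

(** Induction on [m]: the derivative in the increment of the remainder of [f 0] is the remainder of
    [f 1], one order lower. *)
Lemma le_taylor_remainder (R : realType) (f : nat -> R -> R) (A : R) (m : nat) :
  (forall j x, is_derive (x : R) 1 (f j) (f j.+1 x)) -> (forall x, `|f m x| <= A) ->
  forall t d, 0 <= d ->
  `|f 0%N (t + d) - \sum_(j < m) f j t * d ^+ j / j`!%:R| <= A * d ^+ m / m`!%:R.
Proof.
elim: m f => [|m IH] f df fA t d d0.
  by rewrite big_ord0 subr0 expr0 fact0 divr1 mulr1.
have {}IH := IH (fun j => f j.+1) (fun j => df j.+1) fA t.
(* For s = 1 and s = -1 this is the bound plus or minus the remainder. It vanishes at 0 and its
   derivative is nonnegative by induction, which gives both halves of the absolute value. *)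
pose r (s x : R) : R := A * x ^+ m.+1 / m.+1`!%:R +
  s * (f 0%N (t + x) - \sum_(j < m.+1) f j t * x ^+ j / j`!%:R).
have dr s x : is_derive (x : R) 1 (r s) (A * x ^+ m / m`!%:R +
    s * (f 1%N (t + x) - \sum_(j < m) f j.+1 t * x ^+ j / j`!%:R)).
  have dX k (c : R) (y : R) : is_derive (y : R) 1 (fun z : R => c * z ^+ k.+1 / k.+1`!%:R) (c * y ^+ k / k`!%:R).
    have -> : (fun z : R => c * z ^+ k.+1 / k.+1`!%:R) =
        (c / k.+1`!%:R) *: ((id : R -> R) ^+ k.+1).
      by apply/funext => z; rewrite /= !fctE mulrAC.
    apply: is_derive_eq.
    rewrite /GRing.scale /= mulr1 factS natrM.
    have : k`!%:R != 0 :> R by rewrite pnatr_eq0 -lt0n fact_gt0.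
    have : k.+1%:R != 0 :> R by rewrite pnatr_eq0.
    move: (y ^+ k) (k`!%:R) (k.+1%:R) => u v w v0 w0; field.
    by rewrite v0 w0.
  have -> : r s = (fun z => A * z ^+ m.+1 / m.+1`!%:R) +
     s *: ((f 0%N \o (fun z => t + z)) - ((fun _ => f 0%N t) +
        \sum_(j < m) (fun z => f j.+1 t * z ^+ j.+1 / j.+1`!%:R))).
    apply/funext => z; rewrite /r big_ord_recl /= expr0 fact0 divr1 mulr1.
    by rewrite !fctE /= fct_sumE.
  have := df 0%N (t + x) => df0.
  have dtx : is_derive (x : R) 1 (fun z : R => t + z) (1 : R).
    have := @is_deriveD _ _ _ (cst t) id x 1 _ _ (is_derive_cst _ _ _) (is_derive_id _ _).
    by rewrite add0r.
  have dcomp := is_derive1_comp df0 dtx.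
  have dsum : is_derive x 1 (\sum_(j < m) (fun z : R => f j.+1 t * z ^+ j.+1 / j.+1`!%:R))
      (\sum_(j < m) f j.+1 t * x ^+ j / j`!%:R) := is_derive_sum (fun j => dX j (f j.+1 t) x).
  have dpoly := is_deriveD (is_derive_cst (f 0%N t) x 1) dsum.
  have := is_deriveD (dX m A x) (is_deriveZ s (is_deriveB dcomp dpoly)).
  by rewrite add0r mulr1.
have r_ge0 s : `|s| = 1 -> 0 <= r s d.
  move=> s1; have -> : 0 = r s 0.
    rewrite /r big_ord_recl big1 => [|j _]; last by rewrite /= expr0n mulr0 mul0r.
    by rewrite expr0n /= mulr0 mul0r !addr0 expr0 fact0 divr1 mulr1 subrr mulr0 addr0.
  apply: (@ger0_derive1_ndecr _ (r s) 0 d) => //.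
  - move=> x; rewrite in_itv /= => /andP[x0 _].
    rewrite derive1E; have [_ ->] := dr s x.
    have := IH x (ltW x0); rewrite -[`|_ - _|]mul1r -s1 -normrM.
    by rewrite ler_norml => /andP[+ _]; rewrite -subr_ge0 opprK addrC.
  - apply: continuous_subspaceT => x.
    apply: differentiable_continuous; apply/derivable1_diffP.
    by have [] := dr s x.
rewrite ler_norml; apply/andP; split.
  have := r_ge0 1 (normr1 _); rewrite /r mul1r; lra.
have := r_ge0 (-1) (normrN1 _); rewrite /r mulN1r; lra.
Qed.

(** The induction runs on the sharper bound 3 - 1/(k+1)!, which is stable because 2/(k+2)! <=
    1/(k+1)!. *)
Lemma sum_inv_fact_le (R : realType) (m : nat) :
  \sum_(j < m) (j`!%:R)^-1 <= 3 :> R.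
Proof.
have H k : \sum_(j < k.+2) (j`!%:R)^-1 <= 3 - (k.+1`!%:R)^-1 :> R.
  elim: k => [|k IH].
    by rewrite !big_ord_recr big_ord0 /= (_ : 1`! = 1%N) // fact0 invr1; lra.
  rewrite big_ord_recr /=.
  have h : (k.+2`!%:R)^-1 *+ 2 <= (k.+1`!%:R)^-1 :> R.
    rewrite (factS k.+1) natrM invfM mulrC -mulrnAr ler_piMr ?invr_ge0 //.
    by rewrite -[_ *+ 2]mulr_natr mulrC ler_pdivrMr ?ltr0n // mul1r ler_nat.
  rewrite mulr2n in h; lra.
case: m => [|[|k]]; first by rewrite big_ord0.
  by rewrite big_ord1 fact0 invr1; lra.
by apply: le_trans (H k) _; rewrite gerBl invr_ge0.
Qed.

(** * Bang's quasianalyticity argument *)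

Section bang.
Variables (R : realType) (M : nat -> R) (F : nat -> R -> R).
Hypothesis M_gt0 : forall k, 0 < M k.
Hypothesis M_logconvex : forall k, M k.+1 ^+ 2 <= M k * M k.+2.
(** Smoothness enters as Taylor's formula with remainder, [F (k + j)] acting as the j-th derivative
    of [F k]. In this form it can be verified for integrals by integrating a pointwise Taylor
    bound. *)
Hypothesis taylorF : forall k m t d, 0 <= d ->
  `|F k (t + d) - \sum_(j < m) F (k + j)%N t * d ^+ j / j`!%:R|
    <= M (k + m)%N * d ^+ m / m`!%:R.

Let F_le k t : `|F k t| <= M k.
Proof.
have := @taylorF k 0 t 0 (lexx _).
by rewrite big_ord0 subr0 addr0 addn0 expr0 mulr1 divr1.
Qed.

Let ratio_mono k j : (k <= j)%N -> M k.+1 / M k <= M j.+1 / M j.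
Proof.
elim: j => [|j IH]; first by rewrite leqn0 => /eqP ->.
rewrite leq_eqVlt => /predU1P[-> //|]; rewrite ltnS => /IH /le_trans; apply.
by rewrite ler_pdivrMr // mulrAC ler_pdivlMr // -expr2 mulrC.
Qed.

(** Each of the [j] ratios passed on the way from [k] to [k + j] is at most the ratio at [p]. *)
Let M_le k j p : (k + j <= p.+1)%N -> M (k + j)%N <= M k * (M p.+1 / M p) ^+ j.
Proof.
elim: j => [|j IH] kjp; first by rewrite addn0 expr0 mulr1.
rewrite addnS exprSr mulrA.
rewrite addnS ltnS in kjp.
apply: (@le_trans _ _ (M (k + j)%N * (M (k + j).+1 / M (k + j)%N))).
  by rewrite mulrCA divff ?mulr1 // gt_eqF.
apply: ler_pM; rewrite ?divr_ge0 ?(ltW (M_gt0 _)) //.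
  by apply: IH; rewrite ltnW.
exact: ratio_mono.
Qed.

(* If F_k(t) is small by a factor 3^-(p+1) relative to 3^k M_k for all k, then a step
   of length M_p / (3 M_{p+1}) loses at most one factor 3 >= e. *)
Let bang_step p t d : 0 <= d -> d <= M p / M p.+1 / 3 ->
  (forall k, `|F k t| <= 3 ^- p.+1 * 3 ^+ k * M k) ->
  forall k, `|F k (t + d)| <= 3 ^- p * 3 ^+ k * M k.
Proof.
move=> d0 dle Ft k.
have q0 i : 0 < 3 ^+ i :> R by rewrite exprn_gt0.
(* For k >= p the trivial bound by [M k] suffices, as 3^(k-p) >= 1. *)
have [pk|kp] := leqP p k.
  apply: le_trans (F_le _ _) _; rewrite ler_peMl ?(ltW (M_gt0 _)) //.
  by rewrite mulrC ler_pdivlMr // mul1r ler_weXn2l // ler1n.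
(* Expanding to total order k + m = p + 1 makes the remainder bound exactly the term j = m of the
   sum below, since 3^(-(p+1)) 3^(k+m) = 1. *)
set m := (p.+1 - k)%N.
have km : (k + m)%N = p.+1 by rewrite subnKC // ltnW // ltnW.
have := @taylorF k m t d d0; rewrite km => taylor.
have bound : `|F k (t + d)| <= 3 ^- p.+1 *
    \sum_(j < m.+1) 3 ^+ (k + j) * M (k + j)%N * d ^+ j / j`!%:R.
  rewrite -[F k (t + d)](subrK (\sum_(j < m) F (k + j)%N t * d ^+ j / j`!%:R)).
  rewrite addrC; apply: le_trans (ler_normD _ _) _.
  rewrite big_ord_recr /= mulrDr; apply: lerD; last first.
    apply: le_trans taylor _.
    by rewrite km !mulrA mulVf ?mul1r // gt_eqF.
  apply: le_trans (ler_norm_sum _ _ _) _.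
  rewrite mulr_sumr; apply: ler_sum => j _.
  rewrite -mulrA normrM [`|d ^+ j / _|]ger0_norm ?divr_ge0 ?exprn_ge0 //.
  have -> : 3 ^- p.+1 * (3 ^+ (k + j) * M (k + j)%N * d ^+ j / j`!%:R) =
      3 ^- p.+1 * 3 ^+ (k + j) * M (k + j)%N * (d ^+ j / j`!%:R) by rewrite !mulrA.
  by apply: ler_wpM2r; rewrite ?divr_ge0 ?exprn_ge0.
apply: le_trans bound _.
have -> : 3 ^- p * 3 ^+ k * M k = 3 ^- p.+1 * (3 ^+ k * M k * 3) :> R.
  by rewrite exprS invfM; field; rewrite gt_eqF.
rewrite ler_wpM2l ?invr_ge0 ?(ltW (q0 _)) //.
apply: le_trans (_ : _ <= 3 ^+ k * M k * \sum_(j < m.+1) (j`!%:R)^-1) _; last first.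
  by rewrite ler_wpM2l ?sum_inv_fact_le // mulr_ge0 // ltW.
rewrite mulr_sumr; apply: ler_sum => j _.
rewrite ler_wpM2r ?invr_ge0 // exprD -!mulrA ler_wpM2l ?(ltW (q0 _)) //.
have kj : (k + j <= p.+1)%N by rewrite -km leq_add2l -ltnS.
(* The step length makes (3 d M_(p+1) / M_p)^j <= 1, so only the inverse factorials remain, and they
   sum to at most 3. *)
apply: le_trans (_ : _ <= 3 ^+ j * (M k * (M p.+1 / M p) ^+ j * d ^+ j)) _.
  by rewrite ler_wpM2l ?(ltW (q0 _)) // ler_wpM2r ?exprn_ge0 // M_le.
rewrite -mulrA mulrCA ler_piMr ?(ltW (M_gt0 _)) //.
rewrite -!exprMn exprn_ile1 ?mulr_ge0 ?divr_ge0 ?invr_ge0 ?(ltW (M_gt0 _)) //.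
rewrite mulrC -ler_pdivlMr // mulrC -ler_pdivlMr ?divr_gt0 //.
by rewrite invf_div mul1r mulrC.
Qed.

Hypothesis F0 : forall k, F k 0 = 0.
Hypothesis ratio_divergence :
  forall A : R, exists n, A <= \sum_(j < n) M j / M j.+1.

(** Walk from 0 to [t] with steps of length at most M_j / (3 M_(j+1)), the index j decreasing to
    [p]. Divergence lets such a walk reach [t] for every [p], hence |F_0(t)| <= 3^(-p) M_0 for all
    [p]. *)
Lemma bang_quasianalyticity t : 0 <= t -> F 0%N t = 0.
Proof.
move=> t0.
have walk n p s : 0 <= s -> s <= \sum_(p <= j < p + n) M j / M j.+1 / 3 ->
    forall k, `|F k s| <= 3 ^- p * 3 ^+ k * M k.
  elim: n p s => [|n IH] p s s0.
    rewrite addn0 big_geq // => s0' k.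
    have -> : s = 0 by apply/eqP; rewrite eq_le s0 s0'.
    by rewrite F0 normr0 !mulr_ge0 ?invr_ge0 ?exprn_ge0 ?(ltW (M_gt0 _)).
  rewrite addnS big_ltn ?ltnS ?leq_addr // -addSn => sle.
  set S := \sum_(_ <= _ < _) _ in sle.
  have S0 : 0 <= S.
    by apply: sumr_ge0 => j _; rewrite !divr_ge0 ?(ltW (M_gt0 _)).
  (* If the later indices already cover [s], a step of length 0 merely gives up one factor 3. *)
  have [sS|Ss] := leP s S.
    move=> k; have := bang_step (d := 0) (p := p) (t := s) (lexx _).
    by rewrite addr0; apply; [rewrite !divr_ge0 ?(ltW (M_gt0 _))|exact: IH].
  rewrite -(subrKC S s); apply: bang_step.
  - by rewrite subr_ge0 ltW.
  - by rewrite lerBlDr.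
  - exact: IH.
have F_small p : `|F 0%N t| <= 3 ^- p * M 0%N.
  (* The first [p] ratios are added to the target because the walk uses only indices from [p] on. *)
  have [n nA] := ratio_divergence (t * 3 + \sum_(j < p) M j / M j.+1).
  have := walk n p t t0.
  suff H : t <= \sum_(p <= j < p + n) M j / M j.+1 / 3.
    by move=> /(_ H 0%N); rewrite expr0 mulr1.
  rewrite -mulr_suml ler_pdivlMr //.
  rewrite -(lerD2r (\sum_(j < p) M j / M j.+1)); apply: le_trans nA _.
  rewrite addrC -!(big_mkord xpredT (fun j => M j / M j.+1)).
  rewrite -big_cat_nat ?leq_addr //= (@big_cat_nat _ _ _ n 0 (p + n)) ?leq_addl //=.
  by rewrite lerDl; apply: sumr_ge0 => j _; rewrite divr_ge0 ?(ltW (M_gt0 _)).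
apply/eqP; rewrite -normr_eq0 eq_le normr_ge0 andbT leNgt; apply/negP => Fgt0.
have := @cvg_geometric _ (M 0%N) (3^-1 : R).
rewrite normfV ger0_norm // invf_lt1 // ltr1n => /(_ isT).
move/cvgrPdist_lt => /(_ _ Fgt0)[N _ /(_ N (leqnn _))].
rewrite /= sub0r normrN ger0_norm; last first.
  by rewrite mulr_ge0 ?exprn_ge0 ?invr_ge0 // ltW.
by rewrite mulrC exprVn => /(le_lt_trans (F_small N)); rewrite ltxx.
Qed.

End bang.

(** * Gaussians as limits of powers of cosines *)

Lemma expRN_le1 (R : realType) (x : R) : 0 <= x -> expR (- x) <= 1.
Proof. by move=> x0; rewrite -[leRHS]expR0 ler_expR oppr_le0. Qed.

Lemma expRN_mono (R : realType) (s x y : R) :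
  0 <= s -> x <= y -> expR (- (s * y)) <= expR (- (s * x)).
Proof. by move=> s0 xy; rewrite ler_expR lerN2 ler_wpM2l. Qed.

Section bounded_gaussian_approximation.
Context {R : realType}.
Implicit Types x y : R.

(** The derivatives of cos are its shifts by multiples of pi/2, all bounded by 1. Evenness reduces
    to the nonnegative increments of the Taylor bound. *)
Lemma cos_taylor4 y : `|cos y - (1 - y ^+ 2 / 2)| <= y ^+ 4 / 24.
Proof.
wlog y0 : y / 0 <= y => [H|].
  have [/H //|y0] := leP 0 y.
  have := H (- y); rewrite cosN sqrrN (_ : (- y) ^+ 4 = y ^+ 4); last by ring.
  by apply; rewrite oppr_ge0 ltW.
pose f j x := cos (x + j%:R * (pi / 2)).
have df j x : is_derive (x : R) 1 (f j) (f j.+1 x).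
  rewrite /f -[j.+1%:R]natr1 (mulrDl j%:R) mul1r addrA cosDpihalf.
  have dx : is_derive x 1 (fun z => z + j%:R * (pi / 2)) 1.
    have := @is_deriveD _ _ _ id (cst (j%:R * (pi / 2))) x 1 _ _
      (is_derive_id _ _) (is_derive_cst _ _ _).
    by rewrite addr0.
  have := @is_derive1_comp R cos (fun z => z + j%:R * (pi / 2)) x _ _ (is_derive_cos _) dx.
  by rewrite mulr1.
have fA x : `|f 4%N x| <= 1 by exact: cos_max.
have := le_taylor_remainder df fA 0 y0.
rewrite !big_ord_recr big_ord0 /f /= !add0r !mul0r mul1r.
have -> : 2 * (pi / 2) = pi :> R by rewrite mulrC divfK.
have -> : 3 * (pi / 2) = pi + pi / 2 :> R by field.
rewrite cos0 cospi cosDpihalf sinpi cos_pihalf addr0.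
rewrite (_ : 4`! = 24)%N // (_ : 2`! = 2)%N // fact0 expr0.
by rewrite !(mul0r, oppr0, addr0, mulN1r, mulNr, mul1r, invr1).
Qed.

(** Since exp(-y) <= 1/(1+y), it suffices that (y^2 + 1 - y)(1 + y) = 1 + y^3 >= 1. *)
Lemma expRN_taylor2 y : 0 <= y -> `|expR (- y) - (1 - y)| <= y ^+ 2.
Proof.
move=> y0; rewrite ger0_norm; last by rewrite subr_ge0 expR_ge1Dx.
rewrite lerBlDr expRN -[leLHS]div1r ler_pdivrMr ?expR_gt0 //.
apply: le_trans (_ : _ <= (y ^+ 2 + (1 - y)) * (1 + y)) _.
  have -> : (y ^+ 2 + (1 - y)) * (1 + y) = 1 + y ^+ 3 by ring.
  by rewrite lerDl exprn_ge0.
by rewrite ler_wpM2l ?expR_ge1Dx //; have := sqr_ge0 (y - 2^-1); nra.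
Qed.

(** The n-th powers of two numbers of modulus at most 1 differ by at most [n] times the difference
    of the numbers, here at most y^4/24 + y^4/4. *)
Lemma cosX_gauss y n : `|cos y ^+ n - expR (- (y ^+ 2 / 2)) ^+ n| <= n%:R * y ^+ 4.
Proof.
have y2 : 0 <= y ^+ 2 / 2 by rewrite divr_ge0 ?sqr_ge0.
have y4 : 0 <= y ^+ 4 by rewrite -[4%N]/(2 * 2)%N exprM sqr_ge0.
have cosexp : `|cos y - expR (- (y ^+ 2 / 2))| <= y ^+ 4.
  have := cos_taylor4 y; have := expRN_taylor2 y2.
  have -> : (y ^+ 2 / 2) ^+ 2 = y ^+ 4 / 4 by field.
  by rewrite !ler_norml => /andP[? ?] /andP[? ?]; apply/andP; split; lra.
rewrite subrXX normrM mulrC; apply: ler_pM => //.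
apply: le_trans (ler_norm_sum _ _ _) _.
rewrite -[leRHS]mulr1 mulr_natl -[in leRHS](card_ord n) -sumr_const.
apply: ler_sum => i _; rewrite normrM !normrX.
apply: mulr_ile1; rewrite ?exprn_ge0 // exprn_ile1 ?cos_max //.
by rewrite ger0_norm ?expR_ge0 // expRN_le1.
Qed.

End bounded_gaussian_approximation.

Definition gauss (R : realType) (t c x : R) : R := expR (- ((t * (x - c)) ^+ 2 / 2)).

Lemma gauss_le1 (R : realType) (t c x : R) : `|gauss t c x| <= 1.
Proof.
by rewrite ger0_norm ?expR_ge0 // expRN_le1 // divr_ge0 ?sqr_ge0.
Qed.

Lemma measurable_gauss (R : realType) (t c : R) : measurable_fun setT (gauss t c).
Proof.
apply: (measurableT_comp (@measurable_expR R)).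
apply: continuous_measurable_fun => x.
apply: cvgN; apply: cvgM; last exact: cvg_cst.
apply: (@cvg_comp _ _ _ (fun x => t * (x - c)) (fun y => y ^+ 2)); last exact: exprn_continuous.
by apply: cvgM; [exact: cvg_cst|apply: cvgB; [exact: cvg_id|exact: cvg_cst]].
Qed.

(** * Functionals of quasianalytic growth that annihilate polynomials *)

Section quasianalytic_functional.
(** In the application [E phi] is the difference of the integrals of phi(u) G and phi(u') G', and
    [P] collects the measurable [phi] for which both converge, so that [E] is linear there. *)
Variables (R : realType) (P : (R -> R) -> Prop) (E : (R -> R) -> R).
Variable M : nat -> R.
Hypothesis M_gt0 : forall k, 0 < M k.
Hypothesis M_logconvex : forall k, M k.+1 ^+ 2 <= M k * M k.+2.
Hypothesis ratio_divergence :
  forall A : R, exists n, A <= \sum_(j < n) M j / M j.+1.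
(** Two powers occur because the error in approximating a Gaussian centred at [c] is bounded by a
    multiple of x^4 plus a constant. *)
Hypothesis E_bound : forall (phi : R -> R) (k l : nat) (A B : R),
  0 <= A -> 0 <= B ->
  measurable_fun setT phi ->
  (forall x, `|phi x| <= A * `|x| ^+ k + B * `|x| ^+ l) ->
  P phi /\ `|E phi| <= A * M k + B * M l.
Hypothesis P_measurable : forall phi, P phi -> measurable_fun setT phi.
Hypothesis E_linear : forall a phi psi, P phi -> P psi ->
  P (fun x => a * phi x + psi x) /\
  E (fun x => a * phi x + psi x) = a * E phi + E psi.
Hypothesis E_moment : forall k, E (fun x => x ^+ k) = 0.

(* The k-th derivative of cos (t x + c) with respect to t. *)
Let wave k t c x : R := x ^+ k * cos (t * x + c + k%:R * (pi / 2)).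

Let measurable_affine_cos (t c : R) : measurable_fun setT (fun x : R => cos (t * x + c)).
Proof.
have mcos : measurable_fun setT (@cos R).
  by apply: continuous_measurable_fun; exact: continuous_cos.
apply: (measurableT_comp mcos).
apply: measurable_funD; last exact: measurable_cst.
by apply: measurable_funM; [exact: measurable_cst|exact: measurable_id].
Qed.

Let wave_P k t c : P (wave k t c).
Proof.
apply: (proj1 (@E_bound _ k 0 1 0 _ _ _ _)) => //.
  apply: measurable_funM; first by apply: measurable_funX; exact: measurable_id.
  have -> : (fun x : R => cos (t * x + c + k%:R * (pi / 2))) =
     (fun x => cos (t * x + (c + k%:R * (pi / 2)))).
    by apply/funext => x; rewrite addrA.
  exact: measurable_affine_cos.
move=> x; rewrite mul0r addr0 mul1r normrM normrX.
by rewrite ler_piMr ?exprn_ge0 ?cos_max.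
Qed.

Let E_sum m (c : nat -> R) (psi : nat -> R -> R) phi :
  P phi -> (forall j, P (psi j)) ->
  P (fun x => phi x - \sum_(j < m) psi j x * c j) /\
  E (fun x => phi x - \sum_(j < m) psi j x * c j) =
  E phi - \sum_(j < m) E (psi j) * c j.
Proof.
move=> Pphi Ppsi; elim: m => [|m [IHP IHE]].
  have -> : (fun x => phi x - \sum_(j < 0) psi j x * c j) = phi.
    by apply/funext => x; rewrite big_ord0 subr0.
  by rewrite big_ord0 subr0.
have -> : (fun x => phi x - \sum_(j < m.+1) psi j x * c j) =
    (fun x => - c m * psi m x + (phi x - \sum_(j < m) psi j x * c j)).
  by apply/funext => x; rewrite big_ord_recr /=; ring.
have [? ->] := E_linear (- c m) (Ppsi m) IHP; split => //.
by rewrite IHE big_ord_recr /=; ring.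
Qed.

Let E_zero : P (fun=> 0) /\ E (fun=> 0) = 0.
Proof.
have [P0 _] := @E_bound (fun=> 0) 0 0 0 0 (lexx _) (lexx _) (measurable_cst _)
  (fun x => ltac:(by rewrite normr0 !mul0r addr0)).
split=> //; have [_] := E_linear (-1) P0 P0; rewrite [_ * E _]mulN1r addNr => e.
by rewrite -[RHS]e; congr E; apply/funext => x; rewrite mulr0 addr0.
Qed.

Let E_combination a b phi psi : P phi /\ E phi = 0 -> P psi /\ E psi = 0 ->
  P (fun x => a * phi x + b * psi x) /\ E (fun x => a * phi x + b * psi x) = 0.
Proof.
move=> [Pphi Ephi] [Ppsi Epsi].
have [P0 E0] := E_zero.
have [P1] := E_linear b Ppsi P0; rewrite E0 Epsi mulr0 addr0 => E1.
have [P2] := E_linear a Pphi P1; rewrite E1 Ephi mulr0 addr0 => E2.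
have -> : (fun x => a * phi x + b * psi x) = (fun x => a * phi x + (b * psi x + 0)).
  by apply/funext => x; rewrite addr0.
by [].
Qed.

(** For a fixed phase, the functions r |-> [E (wave k r b)] satisfy the hypotheses of Bang's
    argument in the parameter [r]. Negative frequencies follow from the evenness of cos. *)
Let E_wave t c : E (fun x => cos (t * x + c)) = 0.
Proof.
have wave0 s b : (fun x => cos (s * x + b)) = wave 0 s b.
  by apply/funext => x; rewrite /wave expr0 mul1r mul0r addr0.
have Epos s b : 0 <= s -> E (wave 0 s b) = 0.
  apply: (@bang_quasianalyticity R M (fun k r => E (wave k r b))) => //; last first.
    (* At parameter 0 the wave is x^k times a constant, so [E] sends it to a multiple of a
       moment. *)
    move=> k; rewrite -[RHS](mulr0 (cos (b + k%:R * (pi / 2)))) -[X in _ = _ * X](E_moment k).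
    have [P0 E0] := E_zero.
    have Pk : P (fun x => x ^+ k).
      apply: (proj1 (@E_bound _ k 0 1 0 _ _ _ _)) => //.
      by move=> x; rewrite mul0r addr0 mul1r normrX.
    have [_] := E_linear (cos (b + k%:R * (pi / 2))) Pk P0.
    rewrite E0 addr0 => <-; congr E; apply/funext => x.
    by rewrite /wave mul0r add0r addr0 mulrC.
  move=> k m r d d0.
  under eq_bigr do rewrite -mulrA.
  have [Pr <-] := E_sum m (fun j => d ^+ j / j`!%:R)
    (wave_P k (r + d) b) (fun j => wave_P (k + j) r b).
  (* Pointwise Taylor formula in the parameter; [E_bound] converts it into the one required of
     [E (wave k r b)]. *)
  have rem x : `|wave k (r + d) b x -
      \sum_(j < m) wave (k + j) r b x * (d ^+ j / j`!%:R)| <=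
      `|x| ^+ (k + m) * (d ^+ m / m`!%:R).
    have dw j r0 : is_derive (r0 : R) 1 (fun s => wave (k + j) s b x) (wave (k + j.+1) r0 b x).
      rewrite /wave addnS -[(k + j).+1%:R]natr1 (mulrDl (k + j)%:R) mul1r addrA cosDpihalf exprSr.
      set z := _ * (pi / 2).
      have dx : is_derive r0 1 (fun s => s * x + b + z) x.
        have -> : (fun s => s * x + b + z) = x *: id + cst (b + z).
          by apply/funext => u; rewrite !fctE /= addrA /GRing.scale /= mulrC.
        by apply: is_derive_eq; rewrite addr0 /GRing.scale /= mulr1.
      have := @is_derive1_comp R cos (fun s => s * x + b + z) r0 _ _ (is_derive_cos _) dx.
      move=> /(is_deriveZ (x ^+ (k + j))).
      by rewrite /GRing.scale /= -mulrA [x * _]mulrC.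
    have wA r0 : `|wave (k + m) r0 b x| <= `|x| ^+ (k + m).
      by rewrite normrM normrX ler_piMr ?exprn_ge0 ?cos_max.
    have := le_taylor_remainder dw wA r d0.
    rewrite addn0 -[X in _ <= X -> _]mulrA.
    by under eq_bigr do rewrite -mulrA.
  have dm : 0 <= d ^+ m / m`!%:R by rewrite divr_ge0 ?exprn_ge0.
  have [] := E_bound (k := (k + m)%N) (l := 0) dm (lexx _) (P_measurable Pr).
    by move=> x; rewrite mul0r addr0 mulrC.
  by move=> _; rewrite mul0r addr0 [_ / _ * _]mulrC mulrA.
have [t0|t0] := leP 0 t; first by rewrite wave0 Epos.
have -> : (fun x => cos (t * x + c)) = wave 0 (- t) (- c).
  by rewrite -wave0; apply/funext => x; rewrite -cosN opprD mulNr.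
by rewrite Epos // oppr_ge0 ltW.
Qed.

(** The extra cosine, of arbitrary frequency and phase, lets the product-to-sum formula drive the
    induction; s = b = 0 gives the pure power. *)
Let E_cosX n t c s b :
  P (fun x => cos (s * x + b) * cos (t * x + c) ^+ n) /\
  E (fun x => cos (s * x + b) * cos (t * x + c) ^+ n) = 0.
Proof.
elim: n s b => [|n IH] s b.
  under eq_fun do rewrite expr0 mulr1.
  split; last exact: E_wave.
  have := wave_P 0 s b; rewrite /wave.
  by under eq_fun do rewrite expr0 mul1r mul0r addr0.
have -> : (fun x => cos (s * x + b) * cos (t * x + c) ^+ n.+1) = (fun x =>
    2^-1 * (cos ((s + t) * x + (b + c)) * cos (t * x + c) ^+ n) +
    2^-1 * (cos ((s - t) * x + (b - c)) * cos (t * x + c) ^+ n)).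
  apply/funext => x.
  have -> : (s + t) * x + (b + c) = (s * x + b) + (t * x + c) by ring.
  have -> : (s - t) * x + (b - c) = (s * x + b) - (t * x + c) by ring.
  by rewrite (cosD (s * x + b) (t * x + c)) (cosB (s * x + b) (t * x + c)) exprS; field.
exact: E_combination.
Qed.

(** With m = N + 1, the power cos(t(x-c)/m)^(m^2) is annihilated by [E] and differs from the
    Gaussian by at most m^2 (t(x-c)/m)^4. *)
Lemma quasianalytic_gauss t c : E (gauss t c) = 0.
Proof.
have [Pg _] : P (gauss t c) /\ `|E (gauss t c)| <= 1 * M 0 + 0 * M 0.
  apply: E_bound => //; first exact: measurable_gauss.
  by move=> x; rewrite expr0 mul0r addr0 mulr1 gauss_le1.
(* The factor 8 comes from (x - c)^4 <= 8 (x^4 + c^4). *)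
pose K := 8 * t ^+ 4 * M 4 + 8 * t ^+ 4 * c ^+ 4 * M 0.
have t4 : 0 <= t ^+ 4 by rewrite -[4%N]/(2 * 2)%N exprM sqr_ge0.
have c4 : 0 <= c ^+ 4 by rewrite -[4%N]/(2 * 2)%N exprM sqr_ge0.
have K0 : 0 <= K.
  have ? := ltW (M_gt0 4); have ? := ltW (M_gt0 0).
  by rewrite /K addr_ge0 // mulr_ge0 // mulr_ge0 // mulr_ge0.
have bound N : `|E (gauss t c)| <= K / N.+1%:R.
  have N0 : 0 < N.+1%:R :> R by [].
  pose u := t / N.+1%:R.
  have [Pc Ec] := E_cosX (N.+1 ^ 2) u (- (u * c)) 0 0.
  set phi := (fun x => _) in Pc Ec.
  have phiE x : phi x = cos (u * (x - c)) ^+ (N.+1 ^ 2).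
    by rewrite /phi mul0r addr0 cos0 mul1r mulrBr.
  have [Pd] := E_linear (-1) Pc Pg; rewrite Ec mulr0 add0r => <-.
  have A0 : 0 <= 8 * t ^+ 4 / N.+1%:R by rewrite divr_ge0 // mulr_ge0.
  have B0 : 0 <= 8 * t ^+ 4 * c ^+ 4 / N.+1%:R by rewrite divr_ge0 // mulr_ge0 // mulr_ge0.
  have [|_] := E_bound (k := 4) (l := 0) A0 B0 (P_measurable Pd); last first.
    by rewrite [_ / _ * M 4]mulrAC [_ / _ * M 0]mulrAC -mulrDl.
  move=> x; rewrite mulN1r addrC distrC phiE expr0 mulr1 -normrX.
  have -> : gauss t c x = expR (- ((u * (x - c)) ^+ 2 / 2)) ^+ (N.+1 ^ 2).
    rewrite -expRM_natl natrX /gauss; congr expR; rewrite /u.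
    by field; rewrite gt_eqF.
  apply: le_trans (cosX_gauss _ _) _.
  have x4 y : 0 <= y ^+ 4 :> R by rewrite -[4%N]/(2 * 2)%N exprM sqr_ge0.
  have -> : (N.+1 ^ 2)%:R * (u * (x - c)) ^+ 4 =
      t ^+ 4 * (x - c) ^+ 4 / N.+1%:R / N.+1%:R.
    by rewrite natrX /u; field; rewrite gt_eqF.
  (* One of the two factors 1/(N+1) is given up; the other still tends to 0. *)
  apply: le_trans (_ : _ <= t ^+ 4 * (x - c) ^+ 4 / N.+1%:R) _.
    rewrite ler_pdivrMr // ler_peMr ?ler1n //.
    by rewrite divr_ge0 // mulr_ge0.
  rewrite (ger0_norm (x4 x)) [_ / _ * x ^+ 4]mulrAC -mulrDl ler_wpM2r ?invr_ge0 //.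
  have xc : (x - c) ^+ 4 <= 8 * (x ^+ 4 + c ^+ 4).
    have h y z : (y - z) ^+ 2 <= 2 * (y ^+ 2 + z ^+ 2) :> R.
      have := sqr_ge0 (y + z); nra.
    have h' y z : 0 <= y -> 0 <= z -> (y + z) ^+ 2 <= 2 * (y ^+ 2 + z ^+ 2) :> R.
      have := sqr_ge0 (y - z); nra.
    have e4 y : y ^+ 4 = (y ^+ 2) ^+ 2 :> R by rewrite -exprM.
    rewrite !e4; apply: le_trans (_ : (2 * ((x ^+ 2) + c ^+ 2)) ^+ 2 <= _).
      apply: lerXn2r; rewrite ?nnegrE ?h ?sqr_ge0 //.
      by apply: mulr_ge0 => //; apply: addr_ge0; exact: sqr_ge0.
    by have := h' (x ^+ 2) (c ^+ 2) (sqr_ge0 _) (sqr_ge0 _); rewrite exprMn; nra.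
  have := ler_wpM2l t4 xc; lra.
apply/eqP; rewrite -normr_eq0 eq_le normr_ge0 andbT leNgt; apply/negP => Eg.
have := archi_boundP (divr_ge0 K0 (ltW Eg)); set N := Num.bound _ => KN.
have := bound N; rewrite leNgt ltr_pdivrMr // => /negP; apply.
rewrite ltr_pdivrMr // in KN; apply: lt_le_trans KN _.
by rewrite mulrC ler_wpM2l // ler_nat.
Qed.

End quasianalytic_functional.

(** * Exchanging a monomial for a Gaussian in one coordinate *)

Section cauchy_schwarz.
Context d (T : measurableType d) (R : realType) (mu : {measure set T -> \bar R}).
Variable D : set T.
Hypothesis mD : measurable D.
Implicit Types f g : T -> R.

Lemma integrable_le f g : measurable_fun D f -> (forall x, D x -> `|f x| <= g x) ->
  mu.-integrable D (EFin \o g) -> mu.-integrable D (EFin \o f).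
Proof.
move=> mf fg; apply: le_integrable => //; first exact/measurable_EFinP.
by move=> x Dx /=; rewrite lee_fin (le_trans (fg x Dx)) ?ler_norm.
Qed.

(** The integral of (s|f| - |g|)^2 is a quadratic in [s] that is nowhere negative. *)
Lemma Rintegral_cauchy_schwarz f g :
  measurable_fun D f -> measurable_fun D g ->
  mu.-integrable D (fun x => (f x ^+ 2)%:E) ->
  mu.-integrable D (fun x => (g x ^+ 2)%:E) ->
  mu.-integrable D (fun x => (`|f x * g x|)%:E) /\
  \int[mu]_(x in D) `|f x * g x| <=
    Num.sqrt (\int[mu]_(x in D) f x ^+ 2) * Num.sqrt (\int[mu]_(x in D) g x ^+ 2).
Proof.
move=> mf mg if2 ig2.
have mfg : measurable_fun D (fun x => `|f x * g x|).
  by apply: measurableT_comp => //; exact: measurable_funM.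
have ifg : mu.-integrable D (fun x => (`|f x * g x|)%:E).
  apply: (integrable_le (g := fun x => f x ^+ 2 + g x ^+ 2)) => //.
    move=> x _; rewrite normr_id ler_norml.
    by apply/andP; split; have := sqr_ge0 (f x + g x); have := sqr_ge0 (f x - g x); nra.
  exact: (integrableD mD if2 ig2).
split=> //.
set a := \int[mu]_(x in D) f x ^+ 2; set b := \int[mu]_(x in D) g x ^+ 2.
set c := \int[mu]_(x in D) `|f x * g x|.
have a0 : 0 <= a by apply: Rintegral_ge0 => x _; exact: sqr_ge0.
have b0 : 0 <= b by apply: Rintegral_ge0 => x _; exact: sqr_ge0.
have c0 : 0 <= c by apply: Rintegral_ge0 => x _; exact: normr_ge0.
have quad s : 0 <= s ^+ 2 * a + - (2 * s) * c + b.
  have i1 := integrableZl mD (s ^+ 2) if2.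
  have i2 := integrableZl mD (- (2 * s)) ifg.
  have i12 := integrableD mD i1 i2.
  rewrite -!RintegralZl // -!RintegralD //.
  apply: Rintegral_ge0 => x _.
  have -> : s ^+ 2 * f x ^+ 2 + - (2 * s) * `|f x * g x| + g x ^+ 2 =
      (s * `|f x| - `|g x|) ^+ 2.
    by rewrite normrM -(real_normK (num_real (f x))) -(real_normK (num_real (g x))); ring.
  exact: sqr_ge0.
suff cab : c ^+ 2 <= a * b.
  by rewrite -sqrtrM // -(ger0_norm c0) -sqrtr_sqr ler_wsqrtr.
(* If a = 0 the quadratic is affine, and with c nonzero this value of [s] would make it -1. *)
have [a_eq0|a_neq0] := eqVneq a 0.
  have [-> |c_neq0] := eqVneq c 0; first by rewrite expr0n mulr_ge0.
  have := quad ((b + 1) / (2 * c)).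
  have -> : - (2 * ((b + 1) / (2 * c))) * c = - (b + 1) by field.
  by rewrite a_eq0; lra.
(* The minimiser of the quadratic. *)
have := quad (c / a).
have -> : (c / a) ^+ 2 * a + - (2 * (c / a)) * c + b = (a * b - c ^+ 2) / a by field.
by rewrite pmulr_lge0 ?invr_gt0 ?lt_def ?a_neq0 // subr_ge0.
Qed.

(** Supplies [E_bound]: Cauchy-Schwarz against the weight [G] replaces a power of [u] by its norm
    bound [N]. *)
Lemma integral_growth_le (phi : R -> R) (u G : T -> R) (N : nat -> R) A B k l :
  measurable_fun D u -> measurable_fun D G ->
  mu.-integrable D (fun x => (G x ^+ 2)%:E) ->
  (forall k, 0 <= N k) ->
  (forall k, mu.-integrable D (fun x => ((u x ^+ k) ^+ 2)%:E)) ->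
  (forall k, \int[mu]_(x in D) (u x ^+ k) ^+ 2 <= N k ^+ 2) ->
  0 <= A -> 0 <= B -> measurable_fun setT phi ->
  (forall x, `|phi x| <= A * `|x| ^+ k + B * `|x| ^+ l) ->
  mu.-integrable D (fun x => (phi (u x) * G x)%:E) /\
  `|\int[mu]_(x in D) (phi (u x) * G x)| <=
    (A * N k + B * N l) * Num.sqrt (\int[mu]_(x in D) G x ^+ 2).
Proof.
move=> mu_ mG iG2 N0 iu uN A0 B0 mphi phiAB.
have CS j : mu.-integrable D (fun x => (`|u x ^+ j * G x|)%:E) /\
    \int[mu]_(x in D) `|u x ^+ j * G x| <=
    N j * Num.sqrt (\int[mu]_(x in D) G x ^+ 2).
  have muj : measurable_fun D (fun x => u x ^+ j) by exact: measurable_funX.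
  have [? le] := Rintegral_cauchy_schwarz muj mG (iu j) iG2; split=> //.
  apply: le_trans le _; rewrite ler_wpM2r ?sqrtr_ge0 //.
  by rewrite -(ger0_norm (N0 j)) -sqrtr_sqr ler_wsqrtr.
have [ik lek] := CS k; have [il lel] := CS l.
have mpG : measurable_fun D (fun x => phi (u x) * G x).
  by apply: measurable_funM => //; exact: measurableT_comp.
have iA := integrableZl mD A ik; have iB := integrableZl mD B il.
have iAB := integrableD mD iA iB.
have le x : D x -> `|phi (u x) * G x| <= A * `|u x ^+ k * G x| + B * `|u x ^+ l * G x|.
  move=> _; rewrite !normrM !normrX !mulrA -mulrDl; exact: ler_wpM2r.
have ipG : mu.-integrable D (fun x => (phi (u x) * G x)%:E).
  exact: (integrable_le mpG le iAB).
split=> //; apply: le_trans (le_normr_Rintegral mD ipG) _.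
apply: le_trans (le_Rintegral mD _ iAB le) _; first exact: integrable_norm.
rewrite RintegralD // !RintegralZl // mulrDl -!mulrA.
by apply: lerD; exact: ler_wpM2l.
Qed.

(** A single sequence [N] controls the powers of [u] and of [u'], so the difference of the two
    integrals has growth N_k C. The constant [C] affects neither log-convexity nor the ratios. *)
Lemma gauss_integral_eq (u u' G G' : T -> R) (N : nat -> R) :
  measurable_fun D u -> measurable_fun D u' ->
  measurable_fun D G -> measurable_fun D G' ->
  mu.-integrable D (fun x => (G x ^+ 2)%:E) ->
  mu.-integrable D (fun x => (G' x ^+ 2)%:E) ->
  (forall k, mu.-integrable D (fun x => ((u x ^+ k) ^+ 2)%:E)) ->
  (forall k, mu.-integrable D (fun x => ((u' x ^+ k) ^+ 2)%:E)) ->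
  (forall k, \int[mu]_(x in D) (u x ^+ k) ^+ 2 <= N k ^+ 2) ->
  (forall k, \int[mu]_(x in D) (u' x ^+ k) ^+ 2 <= N k ^+ 2) ->
  (forall k, 0 <= N k) -> (forall k, N k.+1 ^+ 2 <= N k * N k.+2) ->
  (\sum_(1 <= k <oo) (N k `^ (- k%:R^-1))%:E = +oo)%E ->
  (forall k, \int[mu]_(x in D) (u x ^+ k * G x) = \int[mu]_(x in D) (u' x ^+ k * G' x)) ->
  forall t c,
  \int[mu]_(x in D) (gauss t c (u x) * G x) =
  \int[mu]_(x in D) (gauss t c (u' x) * G' x).
Proof.
move=> mu_ mu'_ mG mG' iG iG' iu iu' uN u'N N0 Nlc Noo mom t c.
pose P (phi : R -> R) := [/\ measurable_fun setT phi,
  mu.-integrable D (fun x => (phi (u x) * G x)%:E) &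
  mu.-integrable D (fun x => (phi (u' x) * G' x)%:E)].
pose E (phi : R -> R) := \int[mu]_(x in D) (phi (u x) * G x) -
  \int[mu]_(x in D) (phi (u' x) * G' x).
(* The summand 1 keeps [C] positive even if both weights have zero norm. *)
pose C := Num.sqrt (\int[mu]_(x in D) G x ^+ 2) +
  Num.sqrt (\int[mu]_(x in D) G' x ^+ 2) + 1.
have C0 : 0 < C by rewrite ltr_wpDl // addr_ge0 ?sqrtr_ge0.
have Npos := logconvex_gt0 N0 Nlc Noo.
apply/eqP; rewrite -subr_eq0; apply/eqP.
apply: (@quasianalytic_gauss R P E (fun k => N k * C)).
- by move=> k; rewrite mulr_gt0.
- by move=> k; rewrite exprMn [leRHS]mulrACA -[C * C]expr2 ler_wpM2r // exprn_ge0 // ltW.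
- move=> A; have [n An] := logconvex_ratio_divergence N0 Nlc Noo A.
  exists n; apply: le_trans An _; apply: ler_sum => j _.
  by rewrite -mulf_div divff ?mulr1 // gt_eqF.
- move=> phi k l A B A0 B0 mphi phiAB.
  have [i1 le1] := integral_growth_le mu_ mG iG N0 iu uN A0 B0 mphi phiAB.
  have [i2 le2] := integral_growth_le mu'_ mG' iG' N0 iu' u'N A0 B0 mphi phiAB.
  split=> //; apply: le_trans (ler_normB _ _) _.
  apply: le_trans (lerD le1 le2) _.
  rewrite -mulrDr !mulrA -mulrDl ler_wpM2l ?addr_ge0 ?mulr_ge0 //.
  by rewrite lerDl.
- by move=> phi [].
- move=> a phi psi [m1 i1 i1'] [m2 i2 i2'].
  have ZD (v H : T -> R) :
      mu.-integrable D (fun x => (phi (v x) * H x)%:E) ->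
      mu.-integrable D (fun x => (psi (v x) * H x)%:E) ->
      mu.-integrable D (fun x => ((a * phi (v x) + psi (v x)) * H x)%:E) /\
      \int[mu]_(x in D) ((a * phi (v x) + psi (v x)) * H x) =
      a * \int[mu]_(x in D) (phi (v x) * H x) + \int[mu]_(x in D) (psi (v x) * H x).
    move=> j1 j2; have j3 := integrableZl mD a j1.
    rewrite -RintegralZl // -RintegralD //.
    under eq_fun do rewrite mulrDl -mulrA.
    split; first exact: (integrableD mD j3 j2).
    by apply: eq_Rintegral => x _; rewrite mulrDl mulrA.
  have [k1 e1] := ZD _ _ i1 i2; have [k2 e2] := ZD _ _ i1' i2'.
  split; last by rewrite /E e1 e2; ring.
  split=> //; apply: measurable_funD => //; exact: measurable_funM.
- by move=> k; rewrite /E mom subrr.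
Qed.

End cauchy_schwarz.

(** * Lebesgue measure on C^n *)

Lemma normc_le (R : rcfType) (z : R[i]) :
  normc z <= `|complex.Re z| + `|complex.Im z|.
Proof.
case: z => a b /=; rewrite -[leRHS]ger0_norm ?addr_ge0 // -[`|_ + _|]sqrtr_sqr ler_wsqrtr //.
rewrite sqrrD !real_normK ?num_real // -addrA lerD2l lerDr.
by rewrite mulrn_wge0 // mulr_ge0.
Qed.

(** Balls of rows have radii in [R[i]]; a positive element there is real, so real radii and
    coordinatewise moduli describe the same topology. *)
Lemma nbhs_rowP (R : realType) (n : nat) (z : 'rV[R[i]]_n) (A : set 'rV[R[i]]_n) :
  nbhs z A <-> exists2 r : R, 0 < r &
    forall w : 'rV_n, (forall j, normc (w 0 j - z 0 j) < r) -> A w.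
Proof.
split.
  move=> /nbhs_ballP[e e0 eA].
  have eE : e = (complex.Re e)%:C.
    by move: e0; rewrite /= ltcE /=; case: (e) => a b /= /andP[/eqP -> _].
  exists (complex.Re e); first by rewrite -ltcR -eE.
  move=> w wz; apply: eA; split=> // i j; rewrite ord1 /ball /= -[`|_|]/((normc _)%:C) eE ltcR.
  by rewrite -(normcN (_ - _)) opprB.
move=> [r r0 rA]; apply/nbhs_ballP; exists r%:C; first by rewrite /= ltcR.
move=> w zw; apply: rA => j; have := zw.2 0 j.
by rewrite /ball /= -[`|_|]/((normc _)%:C) ltcR -normcN opprB.
Qed.

Lemma measurable_tuple_box d (T : measurableType d) (n : nat) (A : 'I_n -> set T) :
  (forall j, measurable (A j)) ->
  measurable [set x : n.-tuple T | forall j, A j (tnth x j)].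
Proof.
move=> mA.
rewrite (_ : [set x | _] = \bigcap_(j in setT) ((fun x : n.-tuple T => tnth x j) @^-1` A j)).
  apply: fin_bigcap_measurable => // j _; rewrite -[X in measurable X]setTI.
  exact: measurable_tnth.
by apply/seteqP; split => [x /= Ax j _|x /= Ax j]; exact: Ax.
Qed.

(** Splitting a tuple into head and tail exhibits the box as a product; the empty box product has
    the unit mass of the one-point space. *)
Lemma power_measure_gt0 d (T : measurableType d) (R : realType)
    (m : {sigma_finite_measure set T -> \bar R}) (n : nat) (A : 'I_n -> set T) :
  (forall j, measurable (A j)) -> (forall j, (0 < m (A j))%E) ->
  (0 < power_measure m n [set x | forall j, A j (tnth x j)])%E.
Proof.
move=> mA A0.
elim: n A mA A0 => [|n IH] A mA A0.
  have -> : [set x : 0.-tuple T | forall j, A j (tnth x j)] = setT.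
    apply/seteqP; split; first by move=> x.
    by move=> x _; case=> k kn.
  by rewrite /= diracT lte01.
rewrite /= /cons_measure /pushforward.
rewrite (_ : _ @^-1` _ = A ord0 `*` [set x : n.-tuple T | forall j : 'I_n, A (lift ord0 j) (tnth x j)]).
  rewrite /prod_measure product_measure1E //; last first.
    by apply: (measurable_tuple_box (A := fun j => A (lift ord0 j))) => j.
  apply: mule_gt0; first exact: A0.
  exact: IH (fun j => mA (lift ord0 j)) (fun j => A0 (lift ord0 j)).
apply/seteqP; split => -[a x] /=.
  move=> H; split; first exact: (H ord0).
  by move=> j; have := H (lift ord0 j); rewrite tnthS.
move=> [H0 H] j; case: (unliftP ord0 j) => [i ->|-> //].
by rewrite tnthS; exact: H.
Qed.

Section boxes.
Context {R : realType} {n : nat}.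
Local Notation X := (n.-tuple (plane R)).

Definition box (c : 'I_n -> R * R) (e : R) : set X :=
  [set x | forall j, (`](c j).1 - e, (c j).1 + e[ `*` `](c j).2 - e, (c j).2 + e[)
                      (tnth x j)].

Lemma measurable_box c e : measurable (box c e).
Proof.
have mI j : measurable (`](c j).1 - e, (c j).1 + e[ `*` `](c j).2 - e, (c j).2 + e[ : set (plane R)).
  exact: measurableX.
exact: measurable_tuple_box mI.
Qed.

Lemma volume_box_gt0 c e : 0 < e -> (0 < volume R n (box c e))%E.
Proof.
move=> e0.
have itv_gt0 (a : R) : (0 < lebesgue_measure `](a - e)%R, (a + e)%R[%classic)%E.
  rewrite lebesgue_measure_itv /= lte_fin ltrD2l gtrN // -EFinB lte_fin subr_gt0.
  by rewrite ltrD2l gtrN.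
pose A j : set (plane R) :=
  `](c j).1 - e, (c j).1 + e[ `*` `](c j).2 - e, (c j).2 + e[.
apply: (@power_measure_gt0 _ _ R _ n A) => j.
  exact: measurableX.
rewrite [ltRHS]product_measure1E //. by apply: mule_gt0; exact: itv_gt0.
Qed.

(** The measurable sets of tuples are generated by coordinates, so an open set is written as a
    countable union of boxes with rational centres. *)
Lemma measurable_preimage_open (U : set 'rV[R[i]]_n) : open U ->
  measurable (of_real_coords @^-1` U : set X).
Proof.
move=> oU.
pose I := ({ffun 'I_n -> rat * rat} * nat)%type.
pose center (q : I) : 'I_n -> R * R := fun j => (ratr (q.1 j).1, ratr (q.1 j).2).
pose B (q : I) := box (center q) (q.2.+1%:R^-1).
rewrite (_ : _ @^-1` _ = \bigcup_(q in [set: I]) 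
    (if `[< B q `<=` of_real_coords @^-1` U >] then B q else set0)).
  apply: countable_bigcupT_measurable; first exact: countableP.
  by move=> q; case: ifP => // _; exact: measurable_box.
apply/seteqP; split => [x Ux|x [q _]]; last by case: ifP => // /asboolP; apply.
have [r r0 rU] := (nbhs_rowP _ _).1 (open_nbhs_nbhs (conj oU Ux)).
(* With half-side w < r/4 and a centre within w of [x], points of the box differ from [x] by less
   than 2w in each real coordinate, hence by less than 4w in modulus. *)
pose m := Num.bound (4 / r).
have mr : 4 * (m.+1%:R^-1) < r.
  rewrite ltr_pdivrMr // mulrC -ltr_pdivrMr //.
  apply: lt_trans (archi_boundP _) _; first by rewrite divr_ge0 // ltW.
  by rewrite ltr_nat.
have m0 : 0 < m.+1%:R^-1 :> R by rewrite invr_gt0.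
have [w wE] : exists w : R, w = m.+1%:R^-1 by eexists.
rewrite -wE in mr m0.
have approx (a : R) : exists q : rat, `|a - ratr q| < w.
  have [|q] := @rat_in_itvoo R (a - w) (a + w).
    by rewrite ltrD2l gtrN.
  rewrite in_itv /= => /andP[q1 q2]; exists q.
  by rewrite ltr_norml; apply/andP; split; lra.
have [q1 q1P] := choice (fun j => approx (tnth x j).1).
have [q2 q2P] := choice (fun j => approx (tnth x j).2).
pose q : I := ([ffun j => (q1 j, q2 j)], m).
have inB y : B q y -> forall j, `|(tnth y j).1 - ratr (q1 j)| < w /\
    `|(tnth y j).2 - ratr (q2 j)| < w.
  move=> By j; have [] := By j; rewrite /= -wE ffunE /= !in_itv /= => /andP[? ?] /andP[? ?].
  by split; rewrite ltr_norml; apply/andP; split; lra.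
exists q => //; case: ifPn => [_|/asboolP[]].
  move=> j; rewrite /= -wE ffunE /=; have := q1P j; have := q2P j.
  by rewrite !ltr_norml !in_itv /= => /andP[? ?] /andP[? ?]; split; apply/andP; split; lra.
move=> y /inB By; apply: rU => j; apply: le_lt_trans (normc_le _) _.
apply: lt_trans mr; rewrite !mxE /=.
have [] := By j; have := q1P j; have := q2P j.
rewrite !ltr_norml => /andP[? ?] /andP[? ?] /andP[? ?] /andP[? ?].
by rewrite (_ : 4 * w = 2 * w + 2 * w); [apply: ltrD; rewrite ltr_norml; apply/andP; split; lra|lra].
Qed.

End boxes.

(** * Rotations and moments *)

Definition rotate (R : realType) (n : nat) (lam : 'I_n -> R[i]) (z : 'rV[R[i]]_n) :
  'rV[R[i]]_n := \row_k (lam k * z 0 k).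

Definition real_coord (R : realType) (n : nat) (i : 'I_n * bool) (z : 'rV[R[i]]_n) : R :=
  if i.2 then Im (z 0 i.1) else Re (z 0 i.1).

Lemma normc_sqr (R : rcfType) (z : R[i]) : normc z ^+ 2 = Re z ^+ 2 + Im z ^+ 2.
Proof. by case: z => a b /=; rewrite sqr_sqrtr // addr_ge0 ?sqr_ge0. Qed.

Lemma normc_ge0 (R : rcfType) (z : R[i]) : 0 <= normc z.
Proof. by case: z => a b; exact: sqrtr_ge0. Qed.

Lemma normr_Re_le (R : rcfType) (z : R[i]) : `|Re z| <= normc z.
Proof. by case: z => a b /=; rewrite -sqrtr_sqr ler_wsqrtr // lerDl sqr_ge0. Qed.

Lemma normr_Im_le (R : rcfType) (z : R[i]) : `|Im z| <= normc z.
Proof. by case: z => a b /=; rewrite -sqrtr_sqr ler_wsqrtr // lerDr sqr_ge0. Qed.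

Lemma normr_real_coord_le (R : realType) (n : nat) (i : 'I_n * bool) (z : 'rV[R[i]]_n) :
  `|real_coord i z| <= normc (z 0 i.1).
Proof. by rewrite /real_coord; case: ifP => _; [exact: normr_Im_le|exact: normr_Re_le]. Qed.

Lemma normcX (R : rcfType) (z : R[i]) k : normc (z ^+ k) = normc z ^+ k.
Proof. by elim: k => [|k IH]; [rewrite !expr0 Normc.normc1|rewrite !exprS Normc.normcM IH]. Qed.

Lemma normc_prod (R : rcfType) I (r : seq I) (F : I -> R[i]) :
  normc (\prod_(i <- r) F i) = \prod_(i <- r) normc (F i).
Proof. by apply: (big_morph _ (@Normc.normcM R) (Normc.normc1 R)). Qed.

Lemma normc_conjc (R : rcfType) (z : R[i]) : normc z^* = normc z.
Proof. by case: z => a b /=; rewrite sqrrN. Qed.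

Lemma monomialM (R : realType) (n : nat) (j : 'I_n) (alpha : {ffun 'I_n -> nat}) (z : 'rV[R[i]]_n) :
  monomial [ffun k => ((k == j) + alpha k)%N] z = z 0 j * monomial alpha z.
Proof.
rewrite /monomial (bigD1 j) //= [in RHS](bigD1 j) //= ffunE eqxx exprS -mulrA.
congr (_ * (_ * _)); apply: eq_bigr => k /negPf kj; by rewrite ffunE kj.
Qed.

Lemma normc_monomial_rotate (R : realType) (n : nat) (lam : 'I_n -> R[i])
    (alpha : {ffun 'I_n -> nat}) (z : 'rV[R[i]]_n) :
  (forall k, normc (lam k) = 1) ->
  normc (monomial alpha (rotate lam z)) = normc (monomial alpha z).
Proof.
move=> lam1; rewrite /monomial !normc_prod; apply: eq_bigr => k _.
by rewrite mxE !normcX Normc.normcM lam1 mul1r.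
Qed.

(** * Measurability of complex-valued functions *)

Section complex_measurability.
Context d (T : measurableType d) (R : realType).
Implicit Types f g : T -> R[i].

Definition complex_measurable f :=
  measurable_fun setT (fun x => Re (f x)) /\ measurable_fun setT (fun x => Im (f x)).

Lemma complex_measurable_cst (c : R[i]) : complex_measurable (fun=> c).
Proof. by split; exact: measurable_cst. Qed.

Lemma complex_measurableM f g : complex_measurable f -> complex_measurable g ->
  complex_measurable (fun x => f x * g x).
Proof.
move=> [rf imf] [rg ig]; split.
  have -> : (fun x => Re (f x * g x)) =
      (fun x => Re (f x) * Re (g x) - Im (f x) * Im (g x)).
    by apply/funext => x; case: (f x) (g x) => a b [].
  by apply: measurable_funB; exact: measurable_funM.
have -> : (fun x => Im (f x * g x)) =
    (fun x => Re (f x) * Im (g x) + Im (f x) * Re (g x)).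
  by apply/funext => x; case: (f x) (g x) => a b [].
by apply: measurable_funD; exact: measurable_funM.
Qed.

Lemma complex_measurable_conjc f : complex_measurable f ->
  complex_measurable (fun x => (f x)^*).
Proof.
move=> [rf imf]; split.
  by have -> : (fun x => Re (f x)^*) = (fun x => Re (f x))
    by apply/funext => x; case: (f x).
have -> : (fun x => Im (f x)^*) = (fun x => - Im (f x)).
  by apply/funext => x; case: (f x).
exact: measurable_funN.
Qed.

Lemma complex_measurable_prod I (r : seq I) (F : I -> T -> R[i]) :
  (forall i, complex_measurable (F i)) ->
  complex_measurable (fun x => \prod_(i <- r) F i x).
Proof.
move=> mF; elim: r => [|i r IH].
  by under eq_fun do rewrite big_nil; exact: complex_measurable_cst.
by under eq_fun do rewrite big_cons; exact: complex_measurableM.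
Qed.

Lemma complex_measurableX f k : complex_measurable f ->
  complex_measurable (fun x => f x ^+ k).
Proof.
move=> mf; elim: k => [|k IH].
  by under eq_fun do rewrite expr0; exact: complex_measurable_cst.
by under eq_fun do rewrite exprS; exact: complex_measurableM.
Qed.

Lemma measurable_normc_sqr f : complex_measurable f ->
  measurable_fun setT (fun x => normc (f x) ^+ 2).
Proof.
move=> [rf imf]; under eq_fun do rewrite normc_sqr.
by apply: measurable_funD; exact: measurable_funX.
Qed.

End complex_measurability.

Section coordinates.
Context {R : realType} {n : nat}.
Local Notation X := (n.-tuple (plane R)).

Lemma complex_measurable_coord (j : 'I_n) :
  complex_measurable (fun x : X => of_real_coords x 0 j).
Proof.
have mt := @measurable_tnth _ (plane R) n j.
split; under eq_fun do rewrite mxE /=.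
  exact: (measurableT_comp measurable_fst mt).
exact: (measurableT_comp measurable_snd mt).
Qed.

Lemma complex_measurable_rotate (lam : 'I_n -> R[i]) (j : 'I_n) :
  complex_measurable (fun x : X => rotate lam (of_real_coords x) 0 j).
Proof.
under eq_fun do rewrite mxE.
apply: complex_measurableM; first exact: complex_measurable_cst.
exact: complex_measurable_coord.
Qed.

Lemma complex_measurable_monomial (F : X -> 'rV[R[i]]_n) (alpha : {ffun 'I_n -> nat}) :
  (forall j, complex_measurable (fun x => F x 0 j)) ->
  complex_measurable (fun x => monomial alpha (F x)).
Proof.
by move=> mF; apply: complex_measurable_prod => j; exact: complex_measurableX.
Qed.

Lemma measurable_real_coord (F : X -> 'rV[R[i]]_n) (i : 'I_n * bool) :
  (forall j, complex_measurable (fun x => F x 0 j)) ->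
  measurable_fun setT (fun x => real_coord i (F x)).
Proof. by move=> mF; rewrite /real_coord; case: (i.2); have [] := mF i.1. Qed.

End coordinates.

(** * Rotation invariance of polynomial moments *)

Section rotated_moments.
Variables (R : realType) (n : nat) (Omega : set 'rV[R[i]]_n) (lam : 'I_n -> R[i]).
Hypothesis openOmega : open Omega.
Hypothesis monomial_sqi : forall alpha, square_integrable Omega (monomial alpha).
Hypothesis lam1 : forall k, normc (lam k) = 1.
Local Notation X := (n.-tuple (plane R)).
Local Notation mu := (volume R n).
Local Notation D := (of_real_coords @^-1` Omega).

Let mD : measurable (D : set X).
Proof. exact: measurable_preimage_open. Qed.

(** Integrability is bundled with the equality so that the property passes to linear
    combinations. *)
Definition rotation_invariant (h : 'rV[R[i]]_n -> R) : Prop :=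
  [/\ mu.-integrable D (fun x => (h (of_real_coords x))%:E),
      mu.-integrable D (fun x => (h (rotate lam (of_real_coords x)))%:E) &
      real_integral Omega h = real_integral Omega (h \o rotate lam)].

Let complex_invariant (f : 'rV[R[i]]_n -> R[i]) : Prop :=
  rotation_invariant (fun z => Re (f z)) /\ rotation_invariant (fun z => Im (f z)).

Let invariant_combination a b h1 h2 :
  rotation_invariant h1 -> rotation_invariant h2 ->
  rotation_invariant (fun z => a * h1 z + b * h2 z).
Proof.
move=> [i1 j1 e1] [i2 j2 e2].
have ai1 := integrableZl mD a i1; have bi2 := integrableZl mD b i2.
have aj1 := integrableZl mD a j1; have bj2 := integrableZl mD b j2.
split.
- exact: (integrableD mD ai1 bi2).
- exact: (integrableD mD aj1 bj2).
- rewrite /real_integral /= !RintegralD // !RintegralZl //.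
  by move: e1 e2; rewrite /real_integral /= => -> ->.
Qed.

Let complex_combination a b f g : complex_invariant f -> complex_invariant g ->
  complex_invariant (fun z => a * f z + b * g z).
Proof.
move=> [rf imf] [rg ig]; split.
  have -> : (fun z => Re (a * f z + b * g z)) = (fun z =>
      1 * (Re a * Re (f z) + (- Im a) * Im (f z)) +
      1 * (Re b * Re (g z) + (- Im b) * Im (g z))).
    by apply/funext => z; case: (a) (b) (f z) (g z) => ? ? [? ?] [? ?] [? ?] /=; ring.
  by do 2!apply: invariant_combination => //; exact: invariant_combination.
have -> : (fun z => Im (a * f z + b * g z)) = (fun z =>
    1 * (Re a * Im (f z) + Im a * Re (f z)) +
    1 * (Re b * Im (g z) + Im b * Re (g z))).
  by apply/funext => z; case: (a) (b) (f z) (g z) => ? ? [? ?] [? ?] [? ?] /=; ring.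
by do 2!apply: invariant_combination => //; exact: invariant_combination.
Qed.

Let mrot j := complex_measurable_rotate lam j.
Let mcoord (j : 'I_n) := @complex_measurable_coord R n j.

Lemma integrable_monomial_sqr (F : X -> 'rV[R[i]]_n) alpha :
  (forall j, complex_measurable (fun x => F x 0 j)) ->
  (forall x, normc (monomial alpha (F x)) = normc (monomial alpha (of_real_coords x))) ->
  mu.-integrable D (fun x => (normc (monomial alpha (F x)) ^+ 2)%:E).
Proof.
move=> mF FE; under eq_fun do rewrite FE; exact: monomial_sqi.
Qed.

(** [F] stands for the point before or after rotation, which have equal moduli of monomials. The
    product is dominated by the sum of the two squared moduli. *)
Lemma integrable_monomialM (F : X -> 'rV[R[i]]_n) alpha beta :
  (forall j, complex_measurable (fun x => F x 0 j)) ->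
  (forall al x, normc (monomial al (F x)) = normc (monomial al (of_real_coords x))) ->
  mu.-integrable D (fun x => (Re (monomial alpha (F x) * (monomial beta (F x))^*))%:E) /\
  mu.-integrable D (fun x => (Im (monomial alpha (F x) * (monomial beta (F x))^*))%:E).
Proof.
move=> mF FE.
have [mr mi] : complex_measurable (fun x => monomial alpha (F x) * (monomial beta (F x))^*).
  by apply: complex_measurableM; [|apply: complex_measurable_conjc];
    exact: complex_measurable_monomial.
have := integrableD mD (integrable_monomial_sqr mF (FE alpha))
  (integrable_monomial_sqr mF (FE beta)).
have le x : normc (monomial alpha (F x) * (monomial beta (F x))^*) <=
    normc (monomial alpha (F x)) ^+ 2 + normc (monomial beta (F x)) ^+ 2.
  rewrite Normc.normcM normc_conjc.
  have := sqr_ge0 (normc (monomial alpha (F x)) - normc (monomial beta (F x))).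
  have := sqr_ge0 (normc (monomial alpha (F x)) + normc (monomial beta (F x))).
  nra.
by move=> ig; split; apply: (integrable_le mD _ _ ig);
  [exact: measurable_funTS|move=> x _; apply: le_trans (le x); exact: normr_Re_le
  |exact: measurable_funTS|move=> x _; apply: le_trans (le x); exact: normr_Im_le].
Qed.

Hypothesis inner_rotate : forall alpha beta,
  inner Omega (monomial alpha) (monomial beta) =
  inner Omega (monomial alpha \o rotate lam) (monomial beta \o rotate lam).

Let monomial_invariant alpha beta :
  complex_invariant (fun z => monomial alpha z * (monomial beta z)^*).
Proof.
have [i1 i2] := integrable_monomialM alpha beta mcoord (fun _ _ => erefl).
have [i3 i4] := integrable_monomialM alpha beta mrot
  (fun al x => normc_monomial_rotate al _ lam1).
by have [e1 e2] := inner_rotate alpha beta; split; split.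
Qed.

(** A real coordinate is a combination of z_j and its conjugate, so removing one letter of the word
    raises [alpha] or [beta] by one at j; hence the induction is uniform in both. *)
Let real_word_invariant (s : seq ('I_n * bool)) alpha beta :
  complex_invariant (fun z => (\prod_(i <- s) real_coord i z)%:C *
    (monomial alpha z * (monomial beta z)^*)).
Proof.
elim: s alpha beta => [|[j b] s IH] alpha beta.
  under eq_fun do rewrite big_nil mul1r.
  exact: monomial_invariant.
pose f (z : 'rV[R[i]]_n) := (\prod_(i <- s) real_coord i z)%:C *
  (monomial [ffun k => ((k == j) + alpha k)%N] z * (monomial beta z)^*).
pose g (z : 'rV[R[i]]_n) := (\prod_(i <- s) real_coord i z)%:C *
  (monomial alpha z * (monomial [ffun k => ((k == j) + beta k)%N] z)^*).
(* Re z is half the sum of z and its conjugate; Im z is -i/2 times their difference. *)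
pose a : R[i] := if b then - 'i%C / 2 else 1 / 2.
pose c : R[i] := if b then 'i%C / 2 else 1 / 2.
have -> : (fun z => (\prod_(i <- (j, b) :: s) real_coord i z)%:C *
    (monomial alpha z * (monomial beta z)^*)) = (fun z => a * f z + c * g z).
  apply/funext => z; rewrite big_cons rmorphM /= /f /g !monomialM (rmorphM (@conjc R)) /=.
  have -> : (real_coord (j, b) z)%:C = a * z 0 j + c * (z 0 j)^*.
    rewrite /real_coord /a /c /=; case: b {a c f g}.
      by rewrite ImJ_sub; field.
    by rewrite ReJ_add; field.
  ring.
by apply: complex_combination; exact: IH.
Qed.

Let word_of_exponents (r : seq ('I_n * bool)) (k : 'I_n * bool -> nat) :
  exists s, forall z : 'rV[R[i]]_n,
    \prod_(i <- r) real_coord i z ^+ k i = \prod_(i <- s) real_coord i z.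
Proof.
elim: r => [|i r [s IH]]; first by exists [::] => z; rewrite !big_nil.
exists (nseq (k i) i ++ s) => z.
by rewrite big_cons big_cat /= big_nseq -IH -Monoid.iteropE.
Qed.

Lemma real_monomial_invariant (k : 'I_n * bool -> nat) :
  rotation_invariant (fun z => \prod_i real_coord i z ^+ k i).
Proof.
have [s sE] := word_of_exponents (index_enum _) k.
have [re _] := real_word_invariant s [ffun=> 0%N] [ffun=> 0%N].
have m0 (z : 'rV[R[i]]_n) : monomial [ffun=> 0%N] z = 1 :> R[i].
  by rewrite /monomial big1 // => j _; rewrite ffunE expr0.
suff -> : (fun z : 'rV[R[i]]_n => \prod_i real_coord i z ^+ k i) =
    (fun z : 'rV[R[i]]_n => Re ((\prod_(i <- s) real_coord i z)%:C *
      (monomial [ffun=> 0%N] z * (monomial [ffun=> 0%N] z)^*))) by [].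
by apply/funext => z; rewrite m0 rmorph1 !mulr1 /= sE.
Qed.

End rotated_moments.

(** * From polynomial moments to Gaussian integrals *)

Section gaussian_moments.
Variables (R : realType) (n : nat) (Omega : set 'rV[R[i]]_n) (lam : 'I_n -> R[i]).
Hypothesis openOmega : open Omega.
Hypothesis monomial_sqi : forall alpha, square_integrable Omega (monomial alpha).
Hypothesis condD : forall j, conditionDj Omega j.
Hypothesis lam1 : forall k, normc (lam k) = 1.
Hypothesis inner_rotate : forall alpha beta,
  inner Omega (monomial alpha) (monomial beta) =
  inner Omega (monomial alpha \o rotate lam) (monomial beta \o rotate lam).
Local Notation X := (n.-tuple (plane R)).
Local Notation mu := (volume R n).
Local Notation D := (of_real_coords @^-1` Omega).

Let mD : measurable (D : set X).
Proof. exact: measurable_preimage_open. Qed.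

Let mrot j := complex_measurable_rotate lam j.
Let mcoord (j : 'I_n) := @complex_measurable_coord R n j.

Let normc_rot al (x : X) : normc (monomial al (rotate lam (of_real_coords x))) =
  normc (monomial al (of_real_coords x)).
Proof. exact: normc_monomial_rotate. Qed.

(** Both real coordinates of z_j are bounded by |z_j|, so any real monomial is dominated by the
    modulus of a complex one whose exponents add up the two parts. *)
Let prod_normc (k : 'I_n * bool -> nat) : exists alpha, forall z : 'rV[R[i]]_n,
  \prod_i normc (z 0 i.1) ^+ k i = normc (monomial alpha z).
Proof.
exists [ffun j => (k (j, true) + k (j, false))%N] => z.
rewrite /monomial normc_prod.
rewrite (eq_bigr (fun p => normc (z 0 p.1) ^+ k (p.1, p.2))); last by case.
rewrite -(pair_bigA _ (fun j b => normc (z 0 j) ^+ k (j, b))) /=.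
apply: eq_bigr => j _; rewrite big_bool /= ffunE normcX exprD.
by [].
Qed.

Let monomial_pow (j : 'I_n) (k : nat) : exists alpha, forall z : 'rV[R[i]]_n,
  monomial alpha z = z 0 j ^+ k.
Proof.
exists [ffun i => if i == j then k else 0%N] => z.
rewrite /monomial (bigD1 j) //= ffunE eqxx big1 ?mulr1 // => i /negPf ij.
by rewrite ffunE ij.
Qed.

Let N j k := L2norm Omega (fun z => z 0 j ^+ k).

Let integrable_pow j k : mu.-integrable D (fun x => ((normc (of_real_coords x 0 j) ^+ k) ^+ 2)%:E).
Proof.
have [al alE] := monomial_pow j k; have := monomial_sqi al.
rewrite /square_integrable /abs_sq.
by under eq_fun do rewrite alE normcX.
Qed.

Let N_sqr j k : N j k ^+ 2 = \int[mu]_(x in D) (normc (of_real_coords x 0 j) ^+ k) ^+ 2.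
Proof.
rewrite sqr_sqrtr; last by apply: Rintegral_ge0 => x _; exact: sqr_ge0.
by apply: eq_Rintegral => x _ /=; rewrite /abs_sq normcX.
Qed.

Let measurable_normc_pow j k : measurable_fun D (fun x => normc (of_real_coords x 0 j) ^+ k).
Proof.
apply: measurable_funTS; apply: measurable_funX.
have -> : (fun x => normc (of_real_coords x 0 j)) =
    (fun x : X => Num.sqrt (normc (of_real_coords x 0 j) ^+ 2)).
  by apply/funext => x; rewrite sqrtr_sqr ger0_norm ?normc_ge0.
apply: (measurableT_comp (@continuous_measurable_fun R _ (@sqrt_continuous R))).
exact: measurable_normc_sqr.
Qed.

(** Cauchy-Schwarz for the product of |z_j|^k and |z_j|^(k+2), which is the square of
    |z_j|^(k+1). *)
Let N_logconvex j k : N j k.+1 ^+ 2 <= N j k * N j k.+2.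
Proof.
have [_] := Rintegral_cauchy_schwarz mD (measurable_normc_pow j k)
  (measurable_normc_pow j k.+2) (integrable_pow j k) (integrable_pow j k.+2).
rewrite -!N_sqr !sqrtr_sqr !ger0_norm ?sqrtr_ge0 //; apply: le_trans.
rewrite N_sqr le_eqVlt; apply/orP; left; apply/eqP; apply: eq_Rintegral => x _.
have n0 := normc_ge0 (of_real_coords x 0 j).
rewrite ger0_norm; last by rewrite mulr_ge0 // exprn_ge0.
by rewrite -exprM -exprD; congr (_ ^+ _); lia.
Qed.

Section mixed_moments.
Variables (t : R) (c : 'I_n * bool -> R).

(** [r] lists the coordinates already exchanged for Gaussians; the others still carry powers. *)
Let factor (r : seq ('I_n * bool)) (k : 'I_n * bool -> nat) i (x : R) :=
  if i \in r then gauss t (c i) x else x ^+ k i.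

Let measurable_factor r k i : measurable_fun setT (factor r k i).
Proof. by rewrite /factor; case: (i \in r); [exact: measurable_gauss|exact: exprn_measurable]. Qed.

(** Each step of the induction exchanges one coordinate [j] by [gauss_integral_eq], the weight [G]
    being the product of all other factors. The exponents stay universal because all moments in
    coordinate [j] are used at once. *)
Let mixed_moment r k :
  \int[mu]_(x in D) \prod_i factor r k i (real_coord i (of_real_coords x)) =
  \int[mu]_(x in D) \prod_i factor r k i (real_coord i (rotate lam (of_real_coords x))).
Proof.
elim: r k => [|j r IH] k.
  by have [_ _] := real_monomial_invariant openOmega monomial_sqi lam1 inner_rotate k.
have [jr|jr] := boolP (j \in r).
  have E i x : factor (j :: r) k i x = factor r k i x.
    by rewrite /factor inE; case: eqVneq => [->|//]; rewrite jr.
  have EI (F : X -> 'rV[R[i]]_n) :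
      \int[mu]_(x in D) \prod_i factor (j :: r) k i (real_coord i (F x)) =
      \int[mu]_(x in D) \prod_i factor r k i (real_coord i (F x)).
    by apply: eq_Rintegral => x _; apply: eq_bigr => i _; rewrite E.
  by rewrite EI (EI (fun x => rotate lam (of_real_coords x))).
pose G (F : X -> 'rV[R[i]]_n) x := \prod_(i | i != j) factor r k i (real_coord i (F x)).
have facE (F : X -> 'rV[R[i]]_n) x : \prod_i factor (j :: r) k i (real_coord i (F x)) =
    gauss t (c j) (real_coord j (F x)) * G F x.
  rewrite (bigD1 j) //= /factor inE eqxx /=; congr (_ * _).
  by apply: eq_bigr => i /negPf ij; rewrite inE ij.
have facX m (F : X -> 'rV[R[i]]_n) x :
    \prod_i factor r (fun i => if i == j then m else k i) i (real_coord i (F x)) =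
    real_coord j (F x) ^+ m * G F x.
  rewrite (bigD1 j) //= /factor (negPf jr) eqxx; congr (_ * _).
  by apply: eq_bigr => i /negPf ij; rewrite ij.
rewrite (eq_Rintegral _ (fun x _ => facE of_real_coords x)).
rewrite (eq_Rintegral _ (fun x _ => facE (fun x => rotate lam (of_real_coords x)) x)).
have mG (F : X -> 'rV[R[i]]_n) : (forall j, complex_measurable (fun x => F x 0 j)) ->
    measurable_fun setT (G F).
  move=> mF; rewrite /G; under eq_fun do rewrite -big_filter.
  apply: (measurable_prod (h := fun i x => factor r k i (real_coord i (F x)))) => i _.
  apply: (measurableT_comp (measurable_factor r k i)); exact: measurable_real_coord.
have iG (F : X -> 'rV[R[i]]_n) : (forall j, complex_measurable (fun x => F x 0 j)) ->
    (forall al x, normc (monomial al (F x)) = normc (monomial al (of_real_coords x))) ->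
    mu.-integrable D (fun x => (G F x ^+ 2)%:E).
  move=> mF FE.
  (* Exponent 0 is taken at [j], which is absent from [G], and at the Gaussian factors, which are at
     most 1. The rest of [G] is dominated by a single square-integrable monomial. *)
  have [al alE] := prod_normc (fun i => if (i == j) || (i \in r) then 0%N else k i).
  apply: (integrable_le mD _ _ (integrable_monomial_sqr monomial_sqi mF (FE al))).
    by apply: measurable_funTS; apply: measurable_funX; exact: mG.
  move=> x _; rewrite normrX -alE.
  rewrite lerXn2r ?nnegrE ?normr_ge0 ?prodr_ge0 // => [i _|]; first by rewrite exprn_ge0 ?normc_ge0.
  rewrite normr_prod (bigD1 j (P := xpredT)) //= eqxx expr0 mul1r.
  apply: ler_prod => i /negPf ->; rewrite normr_ge0 /factor /=.
  case: ifP => _; first by rewrite expr0; exact: gauss_le1.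
  by rewrite normrX lerXn2r ?nnegrE ?normc_ge0 ?normr_real_coord_le.
have iu (F : X -> 'rV[R[i]]_n) m : (forall j, complex_measurable (fun x => F x 0 j)) ->
    (forall x, normc (F x 0 j.1) = normc (of_real_coords x 0 j.1)) ->
    mu.-integrable D (fun x => ((real_coord j (F x) ^+ m) ^+ 2)%:E) /\
    \int[mu]_(x in D) (real_coord j (F x) ^+ m) ^+ 2 <= N j.1 m ^+ 2.
  move=> mF FE.
  have le x : D x -> (real_coord j (F x) ^+ m) ^+ 2 <= (normc (of_real_coords x 0 j.1) ^+ m) ^+ 2.
    move=> _; rewrite -FE -[leLHS]ger0_norm ?sqr_ge0 // !normrX.
    by do 2!(apply: lerXn2r; rewrite ?nnegrE ?exprn_ge0 ?normc_ge0 //); exact: normr_real_coord_le.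
  have ii : mu.-integrable D (fun x => ((real_coord j (F x) ^+ m) ^+ 2)%:E).
    apply: (integrable_le mD _ _ (integrable_pow j.1 m)).
      by apply: measurable_funTS; do 2!apply: measurable_funX; exact: measurable_real_coord.
    by move=> x Dx; rewrite ger0_norm ?sqr_ge0 ?le.
  by split=> //; rewrite N_sqr; apply: le_Rintegral => //; exact: integrable_pow.
have rotE (x : X) : normc (rotate lam (of_real_coords x) 0 j.1) = normc (of_real_coords x 0 j.1).
  by rewrite mxE Normc.normcM lam1 mul1r.
apply: (gauss_integral_eq (N := N j.1) mD).
- exact: measurable_funTS (measurable_real_coord (F := of_real_coords) j mcoord).
- exact: measurable_funTS (measurable_real_coord (F := fun x => rotate lam (of_real_coords x)) j mrot).
- exact: measurable_funTS (mG of_real_coords mcoord).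
- exact: measurable_funTS (mG (fun x => rotate lam (of_real_coords x)) mrot).
- exact: (iG of_real_coords mcoord (fun _ _ => erefl)).
- exact: (iG (fun x => rotate lam (of_real_coords x)) mrot normc_rot).
- by move=> m; have [] := iu of_real_coords m mcoord (fun _ => erefl).
- by move=> m; have [] := iu (fun x => rotate lam (of_real_coords x)) m mrot rotE.
- by move=> m; have [] := iu of_real_coords m mcoord (fun _ => erefl).
- by move=> m; have [] := iu (fun x => rotate lam (of_real_coords x)) m mrot rotE.
- by move=> m; exact: sqrtr_ge0.
- by move=> m; exact: N_logconvex.
- exact: condD.
(* Resetting the exponent at [j] to [m] in the induction hypothesis yields the m-th moment. *)
- move=> m; have := IH (fun i => if i == j then m else k i).
  rewrite (eq_Rintegral _ (fun x _ => facX m of_real_coords x)).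
  by rewrite (eq_Rintegral _ (fun x _ => facX m (fun x => rotate lam (of_real_coords x)) x)).
Qed.

Lemma gaussian_rotation_invariant :
  \int[mu]_(x in D) \prod_i gauss t (c i) (real_coord i (of_real_coords x)) =
  \int[mu]_(x in D) \prod_i gauss t (c i) (real_coord i (rotate lam (of_real_coords x))).
Proof.
have := mixed_moment (index_enum _) (fun=> 0%N).
have E i x : factor (index_enum _) (fun=> 0%N) i x = gauss t (c i) x.
  by rewrite /factor mem_index_enum.
have EI (F : X -> 'rV[R[i]]_n) :
    \int[mu]_(x in D) \prod_i factor (index_enum _) (fun=> 0%N) i (real_coord i (F x)) =
    \int[mu]_(x in D) \prod_i gauss t (c i) (real_coord i (F x)).
  by apply: eq_Rintegral => x _; apply: eq_bigr => i _; rewrite E.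
by rewrite EI (EI (fun x => rotate lam (of_real_coords x))).
Qed.

End mixed_moments.
End gaussian_moments.

(** * Localisation *)

Section rotation_topology.
Variables (R : realType) (n : nat).
Implicit Types (z w : 'rV[R[i]]_n) (lam : 'I_n -> R[i]) (Omega : set 'rV[R[i]]_n).

Lemma real_coord_sqdist z w :
  \sum_i (real_coord i z - real_coord i w) ^+ 2 =
  \sum_j normc (z 0 j - w 0 j) ^+ 2.
Proof.
rewrite (eq_bigr (fun p => (real_coord (p.1, p.2) z - real_coord (p.1, p.2) w) ^+ 2)); last by case.
rewrite -(pair_bigA _ (fun j b => (real_coord (j, b) z - real_coord (j, b) w) ^+ 2)) /=.
apply: eq_bigr => j _; rewrite big_bool /= normc_sqr addrC /real_coord /=.
by case: (z 0 j) (w 0 j) => a b [].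
Qed.

Lemma normc1_neq0 (l : R[i]) : normc l = 1 -> l != 0.
Proof.
by move=> l1; apply/eqP => l0; move/eqP: l1; rewrite l0 Normc.normc0 eq_sym oner_eq0.
Qed.

Lemma rotateVK lam : (forall k, normc (lam k) = 1) ->
  cancel (rotate (fun k => (lam k)^-1)) (rotate lam).
Proof. by move=> lam1 z; apply/rowP => k; rewrite !mxE mulVKf // normc1_neq0. Qed.

Lemma rotateK lam : (forall k, normc (lam k) = 1) ->
  cancel (rotate lam) (rotate (fun k => (lam k)^-1)).
Proof. by move=> lam1 z; apply/rowP => k; rewrite !mxE mulKf // normc1_neq0. Qed.

Lemma normc_rotate_sub lam z w j : (forall k, normc (lam k) = 1) ->
  normc (rotate lam z 0 j - rotate lam w 0 j) = normc (z 0 j - w 0 j).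
Proof. by move=> lam1; rewrite !mxE -mulrBr Normc.normcM lam1 mul1r. Qed.

Lemma nbhs_rotate lam z (B : set 'rV[R[i]]_n) : (forall k, normc (lam k) = 1) ->
  nbhs (rotate lam z) B -> nbhs z (rotate lam @^-1` B).
Proof.
move=> lam1 /nbhs_rowP[r r0 rB]; apply/nbhs_rowP; exists r => // w wz.
by apply: rB => j; rewrite normc_rotate_sub.
Qed.

(** A nonempty relatively clopen part meets the dense subset [Omega], hence contains it by
    connectedness, and being relatively closed it contains everything in the closure. *)
Lemma interior_closure_domain Omega : domain Omega -> domain (closure Omega)^°.
Proof.
move=> [[p Op] oO cO].
have sub : Omega `<=` (closure Omega)^° by rewrite -open_subsetE //; exact: subset_closure.
split; [by exists p; exact: sub|exact: open_interior|].
move=> B [b Bb] [C oC BC] [F cF BF].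
have ObC : Omega `&` C = Omega.
  apply: cO.
  - have := Bb; rewrite BC => -[/interior_subset clb Cb].
    by have [q [? ?]] := clb C (open_nbhs_nbhs (conj oC Cb)); exists q.
  - by exists C.
  - exists F => //; apply/seteqP; split => q [Oq].
      by move=> Cq; split=> //; have : B q by [rewrite BC; split=> //; exact: sub]; rewrite BF => -[].
    by move=> Fq; split=> //; have : B q by [rewrite BF; split=> //; exact: sub]; rewrite BC => -[].
apply/seteqP; split => q; first by rewrite BC => -[].
move=> Aq; rewrite BF; split=> //.
have OF : Omega `<=` F.
  move=> s Os; have : (Omega `&` C) s by rewrite ObC.
  move=> [_ Cs].
  have : B s.
    rewrite BC.
    split.
      exact: sub.
    by [].
  rewrite BF.
  by case.
by rewrite ((closure_id F).1 cF); apply: (closure_subset OF); exact: interior_subset.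
Qed.

(** A rotation is a homeomorphism: it carries neighbourhoods of z to neighbourhoods of its image,
    and the inclusion for [Omega] extends to its closure. *)
Lemma rotate_interior_closure_sub lam Omega : (forall k, normc (lam k) = 1) ->
  (forall p, Omega p -> closure Omega (rotate lam p)) ->
  forall z, (closure Omega)^° z -> (closure Omega)^° (rotate lam z).
Proof.
move=> lam1 sub z Az.
have laminv1 k : normc (lam k)^-1 = 1 by rewrite Normc.normcV lam1 invr1.
have : nbhs (rotate lam z) (rotate (fun k => (lam k)^-1) @^-1` closure Omega).
  apply: nbhs_rotate; first exact: laminv1.
  by rewrite rotateK //; exact: Az.
apply: filterS => w clw B Bw.
rewrite -(rotateVK lam1 w) in Bw.
have [q [Oq Bq]] := clw _ (nbhs_rotate lam1 (nbhs_interior Bw)).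
exact: (sub q Oq).
Qed.

Lemma rotate_interior_closure lam Omega : (forall k, normc (lam k) = 1) ->
  (forall p, Omega p -> closure Omega (rotate lam p)) ->
  (forall p, Omega p -> closure Omega (rotate (fun k => (lam k)^-1) p)) ->
  rotate lam @` (closure Omega)^° = (closure Omega)^°.
Proof.
move=> lam1 sub subV; apply/seteqP; split=> [_ [z Az <-]|z Az].
  exact: rotate_interior_closure_sub.
exists (rotate (fun k => (lam k)^-1) z); last exact: rotateVK.
apply: rotate_interior_closure_sub => // k.
by rewrite Normc.normcV lam1 invr1.
Qed.

End rotation_topology.

Section localisation.
Variables (R : realType) (n : nat) (Omega : set 'rV[R[i]]_n) (lam : 'I_n -> R[i]).
Hypothesis openOmega : open Omega.
Hypothesis monomial_sqi : forall alpha, square_integrable Omega (monomial alpha).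
Hypothesis condD : forall j, conditionDj Omega j.
Hypothesis lam1 : forall k, normc (lam k) = 1.
Hypothesis inner_rotate : forall alpha beta,
  inner Omega (monomial alpha) (monomial beta) =
  inner Omega (monomial alpha \o rotate lam) (monomial beta \o rotate lam).
Local Notation X := (n.-tuple (plane R)).
Local Notation mu := (volume R n).
Local Notation D := (of_real_coords @^-1` Omega).

Let sqdist (z w : 'rV[R[i]]_n) := \sum_i (real_coord i z - real_coord i w) ^+ 2.

Let gauss_prodE t z w : \prod_i gauss t (real_coord i w) (real_coord i z) =
  expR (- (t ^+ 2 / 2 * sqdist z w)).
Proof.
rewrite -expR_sum; congr expR; rewrite /sqdist mulr_sumr -sumrN.
by apply: eq_bigr => i _; rewrite exprMn; field.
Qed.

Let integrable_one : mu.-integrable D (fun=> 1%:E).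
Proof.
have := monomial_sqi [ffun=> 0%N]; rewrite /square_integrable /abs_sq.
have m0 (z : 'rV[R[i]]_n) : monomial [ffun=> 0%N] z = 1.
  by rewrite /monomial big1 // => j _; rewrite ffunE expr0.
by under eq_fun do rewrite m0 Normc.normc1 expr1n.
Qed.

(* The Gaussian centred at T p is at most exp(-t^2 r^2 / 2) on Omega, whereas its
   composition with T is at least exp(-t^2 r^2 / 4) on a box around p. *)
Lemma rotate_sub_closure p : Omega p -> closure Omega (rotate lam p).
Proof.
move=> Op; apply: contrapT => /existsNP[B /not_implyP[/nbhs_rowP[r r0 rB] OB]].
set c := rotate lam p in rB.
have mD : measurable (D : set X) by exact: measurable_preimage_open.
have far (x : X) : D x -> r ^+ 2 <= sqdist (of_real_coords x) c.
  move=> Dx; rewrite /sqdist real_coord_sqdist leNgt; apply/negP => lt.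
  apply: OB; exists (of_real_coords x); split=> //; apply: rB => j.
  rewrite -(@ltr_pXn2r _ 2) ?nnegrE ?normc_ge0 ?(ltW r0) //.
  apply: le_lt_trans lt; rewrite (bigD1 j) //= lerDl.
  by apply: sumr_ge0 => k _; rewrite sqr_ge0.
have [r2 r20 r2O] := (nbhs_rowP _ _).1 (open_nbhs_nbhs (conj openOmega Op)).
(* The first bound keeps the box inside [Omega], moduli being below 2e. The second gives 2 n e^2 <=
   r^2/2; [n.+1] avoids dividing by zero when n = 0. *)
pose e := Num.min (r2 / 2) (r / n.+1%:R / 2).
have e0 : 0 < e by rewrite lt_min !divr_gt0.
pose b : set X := box (fun j => (Re (p 0 j), Im (p 0 j))) e.
have mb : measurable b by exact: measurable_box.
have bP x : b x -> forall j, `|Re (of_real_coords x 0 j - p 0 j)| < e /\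
    `|Im (of_real_coords x 0 j - p 0 j)| < e.
  move=> bx j; rewrite mxE; have [] := bx j; rewrite /= !in_itv /=.
  case: (p 0 j) => ? ? /= /andP[? ?] /andP[? ?].
  by split; rewrite ltr_norml; apply/andP; split; lra.
have bD : b `<=` D.
  move=> x /bP bx; apply: r2O => j; apply: le_lt_trans (normc_le _) _.
  have [? ?] := bx j; have : e <= r2 / 2 by rewrite ge_min lexx.
  lra.
have near x : b x -> sqdist (rotate lam (of_real_coords x)) c <= r ^+ 2 / 2.
  move=> bx; rewrite /sqdist real_coord_sqdist.
  apply: le_trans (_ : \sum_(j < n) 2 * e ^+ 2 <= _).
    apply: ler_sum => j _; rewrite normc_rotate_sub // normc_sqr.
    have [] := bP x bx j; set u := Re _; set v := Im _ => ue ve.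
    rewrite -(real_normK (num_real u)) -(real_normK (num_real v)) mulr_natl mulr2n.
    by apply: lerD; apply: lerXn2r; rewrite ?nnegrE ?(ltW e0) // ltW.
  rewrite sumr_const card_ord -[_ *+ n]mulr_natl.
  have e_le : e <= r / n.+1%:R / 2 by rewrite ge_min lexx orbT.
  have e2_le : e ^+ 2 <= (r / n.+1%:R / 2) ^+ 2.
    by apply: lerXn2r => //; rewrite nnegrE ltW // !divr_gt0.
  have nn : n%:R <= n.+1%:R ^+ 2 :> R.
    by rewrite -natrX ler_nat -mulnn; nia.
  apply: le_trans (_ : n.+1%:R ^+ 2 * (2 * (r / n.+1%:R / 2) ^+ 2) <= _).
    by apply: ler_pM => //; [rewrite mulr_ge0 ?sqr_ge0|rewrite ler_wpM2l].
  have : n.+1%:R != 0 :> R by rewrite pnatr_eq0.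
  move: n.+1%:R => N N0.
  by rewrite (_ : N ^+ 2 * _ = r ^+ 2 / 2) //; field.
pose v := \int[mu]_(x in D) (\1_b x : R); pose V := \int[mu]_(x in D) (1 : R).
have ib : mu.-integrable D (fun x => (\1_b x : R)%:E).
  apply: (integrable_le mD _ _ integrable_one); first exact: measurable_indic.
  by move=> x _; rewrite indicE; case: (_ \in _); rewrite ?normr1 ?normr0.
have v0 : 0 < v.
  have vE : (\int[mu]_(x in D) (\1_b x)%:E = mu b)%E.
    by rewrite integral_indic // (setIidl bD).
  rewrite /v /Rintegral vE; apply: fine_gt0.
  have := integrable_fin_num mD ib; rewrite vE => fb.
  by rewrite ltey_eq fb /= andbT; exact: volume_box_gt0.
have bound t : v * expR (- (t ^+ 2 / 2 * (r ^+ 2 / 2))) <= V * expR (- (t ^+ 2 / 2 * r ^+ 2)).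
  have := @gaussian_rotation_invariant R n Omega lam openOmega monomial_sqi condD lam1
    inner_rotate t (fun i => real_coord i c).
  rewrite (eq_Rintegral _ (fun x _ => gauss_prodE t (of_real_coords x) c)).
  rewrite (eq_Rintegral _ (fun x _ => gauss_prodE t (rotate lam (of_real_coords x)) c)) => E.
  have t0 : 0 <= t ^+ 2 / 2 by rewrite divr_ge0 ?sqr_ge0.
  have sq0 z w : 0 <= sqdist z w by apply: sumr_ge0 => i _; rewrite sqr_ge0.
  have mg (F : X -> 'rV[R[i]]_n) : (forall j, complex_measurable (fun x => F x 0 j)) ->
      mu.-integrable D (fun x => (expR (- (t ^+ 2 / 2 * sqdist (F x) c)))%:E).
    move=> mF; apply: (integrable_le mD _ _ integrable_one).
      apply: measurable_funTS; under eq_fun do rewrite -gauss_prodE.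
      apply: (measurable_prod (h := fun i x => gauss t (real_coord i c) (real_coord i (F x)))) => i _.
      apply: (measurableT_comp (measurable_gauss t _)); exact: measurable_real_coord.
    by move=> x _; rewrite (ger0_norm (expR_ge0 _)); exact: expRN_le1 (mulr_ge0 t0 (sq0 _ _)).
  have i1 := mg of_real_coords (@complex_measurable_coord R n).
  have i2 := mg (fun x => rotate lam (of_real_coords x)) (complex_measurable_rotate lam).
  set k1 := expR (- (_ * (r ^+ 2 / 2))); set k2 := expR (- (_ * r ^+ 2)).
  have ik1 : mu.-integrable D (fun x => (k1 * \1_b x)%:E) := integrableZl mD k1 ib.
  have ik2 : mu.-integrable D (fun x => (k2 * 1)%:E) := integrableZl mD k2 integrable_one.
  rewrite mulrC [leRHS]mulrC /v /V -(RintegralZl _ mD ib) -(RintegralZl _ mD integrable_one).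
  apply: le_trans (le_Rintegral mD ik1 i2 _) _.
    move=> x Dx; rewrite indicE; case: (boolP (x \in b)) => [/set_mem bx|_].
      by rewrite mulr1; exact: expRN_mono t0 (near x bx).
    by rewrite mulr0; exact: expR_ge0.
  rewrite -E; apply: (le_Rintegral mD i1 ik2) => x Dx.
  by rewrite mulr1; exact: expRN_mono t0 (far x Dx).
(* For t = 2a/r the bound says v exp(a^2) <= V. But exp(a^2) >= 1 + a^2, a >= 1 and v a = V + v make
   the left side exceed V. *)
pose a := V / v + 1.
have V0 : 0 <= V by apply: Rintegral_ge0.
have a1 : 1 <= a by rewrite lerDr divr_ge0 // ltW.
have := bound (2 * a / r).
have -> : (2 * a / r) ^+ 2 / 2 * (r ^+ 2 / 2) = a ^+ 2 by field; rewrite gt_eqF.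
have -> : (2 * a / r) ^+ 2 / 2 * r ^+ 2 = a ^+ 2 + a ^+ 2 by field; rewrite gt_eqF.
rewrite opprD expRD mulrA ler_pM2r ?expR_gt0 // expRN ler_pdivlMr ?expR_gt0 //.
apply/negP; rewrite -ltNge.
apply: lt_le_trans (_ : v * (1 + a ^+ 2) <= _); last first.
  by rewrite ler_wpM2l ?expR_ge1Dx // ltW.
have va : v * a = V + v by rewrite /a mulrDr mulr1 mulrCA divff ?mulr1 // gt_eqF.
have : v * a <= v * a ^+ 2 by rewrite ler_wpM2l ?(ltW v0) // expr2 ler_peMr // (le_trans ler01).
by rewrite va mulrDr mulr1; lra.
Qed.

End localisation.

(** * From orthogonality relations to symmetry *)

Section orthogonal_monomials.
Variables (R : realType) (n : nat) (Omega : set 'rV[R[i]]_n) (lam : 'I_n -> R[i]).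
Hypothesis hD : conditionD Omega.
Hypothesis lam1 : forall k, `|lam k| = 1.
(** This dichotomy is the common form of the three orthogonality assumptions: monomials that are not
    known to be orthogonal are multiplied by the same factor under the rotation. *)
Hypothesis orthogonal : forall alpha beta,
  inner Omega (monomial alpha) (monomial beta) = 0 \/
  \prod_k lam k ^+ alpha k = \prod_k lam k ^+ beta k.

Let normc_lam k : normc (lam k) = 1.
Proof. exact: (complexI (lam1 k)). Qed.

(** Rotation multiplies the integrand by the constant [q]. Either the integral is 0, and stays so,
    or the two weights agree and q = 1 because they have modulus one. *)
Let inner_rotate alpha beta :
  inner Omega (monomial alpha) (monomial beta) =
  inner Omega (monomial alpha \o rotate lam) (monomial beta \o rotate lam).
Proof.
have [[_ oO _] hA _] := hD.
pose weight (a : {ffun 'I_n -> nat}) := \prod_k lam k ^+ a k.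
have rotE a z : monomial a (rotate lam z) = weight a * monomial a z.
  by rewrite /monomial /weight -big_split; apply: eq_bigr => k _; rewrite mxE exprMn.
pose f (z : 'rV[R[i]]_n) := monomial alpha z * (monomial beta z)^*.
set q := weight alpha * (weight beta)^*.
have fE z : monomial alpha (rotate lam z) * (monomial beta (rotate lam z))^* = q * f z.
  by rewrite !rotE rmorphM /= mulrACA.
have [e0|lamE] := orthogonal alpha beta; last first.
  have q1 : q = 1.
    have n1 : normc (weight beta) = 1.
      by rewrite normc_prod big1 // => k _; rewrite normcX normc_lam expr1n.
    rewrite /q /weight lamE -/(weight beta); move: n1; case: (weight beta) => a b /= ab.
    have ab2 : a ^+ 2 + b ^+ 2 = 1.
      by rewrite -[LHS]sqr_sqrtr ?ab ?expr1n // addr_ge0 ?sqr_ge0.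
    by apply/eqP; rewrite eq_complex /=; apply/andP; split; apply/eqP; [rewrite -ab2|]; ring.
  by rewrite /inner; congr complex_integral; apply/funext => z; rewrite /= fE q1 mul1r.
rewrite e0 /inner /complex_integral /real_integral /=.
have mD := measurable_preimage_open oO.
have [ir ii] := integrable_monomialM oO (fun a => (hA a).2) alpha beta
  (@complex_measurable_coord R n) (fun _ _ => erefl).
move: e0; rewrite /inner /complex_integral /real_integral /= => -[er ei].
have combo (a b : R) :
    \int[volume R n]_(x in of_real_coords @^-1` Omega)
      (a * Re (f (of_real_coords x)) + b * Im (f (of_real_coords x))) = 0.
  have ai := integrableZl mD a ir; have bi := integrableZl mD b ii.
  rewrite (RintegralD mD ai bi) (RintegralZl _ mD ir) (RintegralZl _ mD ii).
  by rewrite /f er ei !mulr0 addr0.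
apply/esym/eqP; rewrite eq_complex /=; apply/andP; split; apply/eqP.
  rewrite -[RHS](combo (Re q) (- Im q)); apply: eq_Rintegral => x _.
  by rewrite fE; case: (q) (f _) => a b [c d] /=; ring.
rewrite -[RHS](combo (Im q) (Re q)); apply: eq_Rintegral => x _.
by rewrite fE; case: (q) (f _) => a b [c d] /=; ring.
Qed.

Lemma rotate_sub_closure_of_orthogonal p : Omega p -> closure Omega (rotate lam p).
Proof.
have [[_ oO _] hA hDj] := hD.
exact: rotate_sub_closure oO (fun a => (hA a).2) hDj normc_lam inner_rotate _.
Qed.

End orthogonal_monomials.

(** The dichotomy passes to the inverse rotation, whose weights are the inverses, so both inclusions
    follow. *)
Lemma rotation_symmetry (R : realType) (n : nat) (Omega : set 'rV[R[i]]_n)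
    (lam : 'I_n -> R[i]) :
  conditionD Omega -> (forall k, `|lam k| = 1) ->
  (forall alpha beta, inner Omega (monomial alpha) (monomial beta) = 0 \/
    \prod_k lam k ^+ alpha k = \prod_k lam k ^+ beta k) ->
  rotate lam @` (closure Omega)^° = (closure Omega)^°.
Proof.
move=> hD lam1 orth; apply: rotate_interior_closure.
- by move=> k; exact: (complexI (lam1 k)).
- exact: rotate_sub_closure_of_orthogonal.
- apply: rotate_sub_closure_of_orthogonal => //.
    by move=> k; rewrite normfV lam1 invr1.
  move=> alpha beta; have [->|e] := orth alpha beta; [by left|right].
  have inv a : \prod_k (lam k)^-1 ^+ a k = (\prod_k lam k ^+ a k)^-1.
    by rewrite -prodfV; apply: eq_bigr => k _; rewrite exprVn.
  by rewrite !inv e.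
Qed.

Theorem theorem1 (R : realType) (n : nat) (Omega : set 'rV[R[i]]_n)
    (hD : conditionD Omega) :
  let Omega' := interior (closure Omega) in
  [/\ (forall alpha beta : {ffun 'I_n -> nat}, alpha <> beta ->
         inner Omega (monomial alpha) (monomial beta) = 0) ->
      reinhardt Omega' /\ (Omega = Omega' -> reinhardt Omega),
      (forall alpha beta : {ffun 'I_n -> nat}, degree alpha <> degree beta ->
         inner Omega (monomial alpha) (monomial beta) = 0) ->
      circular Omega' /\ (Omega = Omega' -> circular Omega)
    & forall j : 'I_n,
      (forall alpha beta : {ffun 'I_n -> nat}, alpha j <> beta j ->
         inner Omega (monomial alpha) (monomial beta) = 0) ->
      hartogs j Omega' /\ (Omega = Omega' -> hartogs j Omega)].
Proof.
have [dO _ _] := hD; have dO' := interior_closure_domain dO.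
split=> [orth|orth|j orth].
(* In each case the weight depends only on what the assumption compares: the whole exponent here,
   the degree for a constant [lam], and the j-th exponent when [lam] is 1 off [j]. *)
- suff H : reinhardt (closure Omega)^° by split=> // ->.
  split=> // lam lam1; apply: (rotation_symmetry hD lam1) => alpha beta.
  by have [->|/eqP /orth] := eqVneq alpha beta; [right|left].
- suff H : circular (closure Omega)^° by split=> // ->.
  split=> // l l1.
  rewrite (_ : (fun z => l *: z) = rotate (fun=> l)); last first.
    by apply/funext => z; apply/rowP => k; rewrite !mxE.
  apply: (rotation_symmetry hD) => // alpha beta.
  have weight a : \prod_(k < n) l ^+ a k = l ^+ (\sum_(k < n) a k).
    by rewrite -expr_sum.
  have [e|/eqP /orth] := eqVneq (degree alpha) (degree beta); [right|by left].
  by rewrite !weight -!/(degree _) e.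
- suff H : hartogs j (closure Omega)^° by split=> // ->.
  split=> // l l1; pose lam k := if k == j then l else 1.
  rewrite (_ : (fun z => _) = rotate lam); last first.
    apply/funext => z; apply/rowP => k; rewrite !mxE /lam.
    by case: ifP => _; rewrite ?mul1r.
  apply: (rotation_symmetry hD) => [k|alpha beta].
    by rewrite /lam; case: ifP => _; rewrite ?normr1.
  have weight (a : {ffun 'I_n -> nat}) : \prod_k lam k ^+ a k = l ^+ a j.
    rewrite (bigD1 j) //= /lam eqxx big1 ?mulr1 // => k /negPf ->.
    by rewrite expr1n.
  have [e|/eqP /orth] := eqVneq (alpha j) (beta j); [right|by left].
  by rewrite !weight e.
Qed.
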